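(* Let $R_c\in SO(3)$, $\rho\in(0,\pi/2)$, $0\le r_0<\rho$, and $\mathcal{C}=\{R\in SO(3):d(R,R_c)\le\rho\}$. For $i=1,\dots,n$ let $k_i>0$, let $R_i^*\in SO(3)$ with $d(R_i^*,R_c)\le r_0$, let $f_i:=\tfrac{k_i}{2}d^2(\cdot,R_i^* )$, and let $F:=\sum_{i=1}^n f_i$. Then: (1) the functions $f_i$ are $C^2$ on a common open neighborhood of $\mathcal{C}$; (2) for every $i$ and every $R$ with $d(R,R_c)=\rho$, $\hat e_c(R)^\top\nabla_R f_i\le0$, where $\hat e_c(R):=(\log(R^\top R_c))^\vee/\|(\log(R^\top R_c))^\vee\|$; (3) $\|\nabla_R f_i\|=k_i\,d(R,R_i^* )\le k_i(\rho+r_0)=:M_i$ for all $R\in\mathcal{C}$, so $M=\max_i M_i$ satisfies $M\ge\max_i\max_{R\in\mathcal{C}}\|\nabla_R f_i\|$; (4) $F$ is geodesically $\mu_F$-strongly convex on $\mathcal{C}$ with $\mu_F=\Bigl(\sum_{i=1}^n k_i\Bigr)\dfrac{\rho+r_0}{2}\cot\dfrac{\rho+r_0}{2}>0$; (5) the minimizer $R^*$ of $F$ over $\mathcal{C}$ satisfies $d(R^*,R_c)\le r_0<\rho$; in particular it lies in the interior of $\mathcal{C}$.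
   Context: $SO(3)$ carries the bi-invariant metric $\langle R\xi^\wedge,R\eta^\wedge\rangle_R=\xi^\top\eta$, where $\xi^\wedge$ is the skew-symmetric matrix with $\xi^\wedge\eta=\xi\times\eta$ and $(\cdot)^\vee$ is the inverse map; $d$ is the geodesic distance, and $d(R,Q)=\|(\log(R^\top Q))^\vee\|$ when $d(R,Q)<\pi$ ($\log$ the principal matrix logarithm). For a $C^2$ function $f$ on an open subset of $SO(3)$, $\nabla_R f\in\mathbb{R}^3$ is the body-coordinate Riemannian gradient, $\operatorname{grad}f(R)=R(\nabla_R f)^\wedge$, and $H_R$ is the matrix of the Riemannian Hessian at $R$ in body coordinates (identifying $R\xi^\wedge\in T_RSO(3)$ with $\xi$). $f$ is geodesically $\mu$-strongly convex on a geodesically convex set $\mathcal{C}$ if $H_R\succeq\mu I_3$ for every $R\in\mathcal{C}$. *)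

(* Defs.v *)
From HB Require Import structures.
From mathcomp Require Import all_boot all_order all_algebra.
From mathcomp Require Import all_classical all_reals all_analysis.
From mathcomp Require Import complex.

Set Implicit Arguments.
Unset Strict Implicit.
Unset Printing Implicit Defensive.

Import Order.TTheory GRing.Theory Num.Theory.
Import numFieldNormedType.Exports.

Local Open Scope classical_set_scope.
Local Open Scope ring_scope.

Section RotationGroup.
Context {R : realType}.
Implicit Types (x y xi : 'cV[R]_3) (A P Q X : 'M[R]_3) (f : 'M[R]_3 -> R).

Definition dot x y : R := (x^T *m y) 0 0.
Definition norm2 x : R := Num.sqrt (dot x x).

(* Indices in 'I_3 are added modulo 3. *)
Definition cross x y : 'cV[R]_3 :=
  \col_i (x (i + 1) 0 * y (i + 2) 0 - x (i + 2) 0 * y (i + 1) 0).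

(* The matrix of the linear map cross xi. *)
Definition hat xi : 'M[R]_3 := \matrix_(i, j) cross xi (delta_mx j 0) i 0.

(* The inverse of hat, meaningful on skew-symmetric matrices only. *)
Definition vee A : 'cV[R]_3 := \col_i A (i + 2) (i + 1).

Definition skew_part A : 'M[R]_3 := 2^-1 *: (A - A^T).

Definition SO3 : set 'M[R]_3 := [set P | P^T *m P = 1%:M /\ \det P = 1].

Definition expm A : 'M[R]_3 :=
  limn (series (fun k => (k`!%:R)^-1 *: A ^+ k)).

(* The logarithm whose eigenvalues lie in the open strip |Im z| < pi.  For a
   real matrix without eigenvalues in ]-oo, 0] it exists, is unique, and is
   real, so it can be sought among the real matrices; otherwise 0 may be
   returned. *)
Definition logm A : 'M[R]_3 :=
  xget 0 [set X | expm X = A /\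
    forall z : R[i], eigenvalue (map_mx (real_complex R) X) z ->
      `|complex.Im z| < pi].

(* A C^1 curve on [0, 1] is taken with a C^1 extension to the real line, of
   which only the restriction to [0, 1] matters. *)
Definition C1_curve (c : R -> 'M[R]_3) : Prop :=
  (forall t, derivable c t 1) /\ continuous (derive1 c).

(* The velocity at t is c t *m hat xi with xi = vee ((c t)^T *m derive1 c t), so
   its length for the bi-invariant metric is norm2 xi. *)
Definition curve_length (c : R -> 'M[R]_3) : R :=
  \int[lebesgue_measure]_(t in `[0, 1]) norm2 (vee ((c t)^T *m derive1 c t)).

(* s is the list of C^1 pieces of a piecewise C^1 curve in SO(3) from P to Q,
   each piece being parametrized by [0, 1]. *)
Fixpoint joins P (s : seq (R -> 'M[R]_3)) Q : Prop :=
  if s is c :: s' then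
    [/\ C1_curve c, forall t, 0 <= t <= 1 -> SO3 (c t), c 0 = P
      & joins (c 1) s' Q]
  else P = Q.

(* Riemannian distance: infimum of the lengths of piecewise C^1 curves. *)
Definition dist P Q : R :=
  inf [set \sum_(c <- s) curve_length c | s in [set s | joins P s Q]].

(* The curve t |-> P exp(t xi^) is the geodesic of the bi-invariant metric
   issued from P with velocity P xi^. *)
Definition geodesic P xi (t : R) : 'M[R]_3 := P *m expm (t *: hat xi).

Definition minimizing P Q xi : Prop :=
  geodesic P xi 1 = Q /\ norm2 xi = dist P Q.

Definition geodesically_convex (C : set 'M[R]_3) : Prop :=
  C `<=` SO3 /\
  forall P Q, C P -> C Q ->
    (exists! xi, minimizing P Q xi) /\
    (forall xi t, minimizing P Q xi -> 0 <= t <= 1 -> C (geodesic P xi t)).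

Definition open_SO3 (U : set 'M[R]_3) : Prop :=
  U `<=` SO3 /\ open (U : set (subspace SO3)).

Definition interior_SO3 (C : set 'M[R]_3) : set 'M[R]_3 :=
  SO3 `&` interior (C : set (subspace SO3)).

(* On an open set of a finite-dimensional space, C^1 amounts to existence and
   continuity of all the directional derivatives. *)
Definition C1_ambient f (W : set 'M[R]_3) : Prop :=
  forall A V, W A -> derivable f A V /\ {for A, continuous ('D_V f)}.

Definition C2_ambient f (W : set 'M[R]_3) : Prop :=
  C1_ambient f W /\ forall V, C1_ambient ('D_V f) W.

(* C^2 functions on an open subset U of the submanifold SO(3): those that
   extend locally to C^2 functions on open sets of matrices. *)
Definition C2_on f (U : set 'M[R]_3) : Prop :=
  forall P, U P -> exists (W : set 'M[R]_3) (g : 'M[R]_3 -> R),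
    [/\ open W, W P, C2_ambient g W & {in W `&` U, f =1 g}].

(* Coordinates of the gradient in the orthonormal basis P (e_i)^ of the
   tangent space at P. *)
Definition nabla f P : 'cV[R]_3 :=
  \col_i derive1 (fun t : R => f (geodesic P (delta_mx i 0) t)) 0.

Definition grad f P : 'M[R]_3 := P *m hat (nabla f P).

(* Body coordinates of the Levi-Civita derivative of the vector field V at P
   in the direction P xi^.  The bi-invariant metric is half the one induced by
   the Frobenius inner product, hence has the same Levi-Civita connection: the
   orthogonal projection onto the tangent space of the derivative of V in the
   space of matrices, the projection being A |-> P skew_part (P^T A). *)
Definition covariant_derivative (V : 'M[R]_3 -> 'M[R]_3) P xi : 'cV[R]_3 :=
  vee (skew_part (P^T *m derive1 (fun t : R => V (geodesic P xi t)) 0)).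

Definition hessian f P : 'M[R]_3 :=
  \matrix_(i, j) covariant_derivative (grad f) P (delta_mx j 0) i 0.

Definition psd A : Prop := A^T = A /\ forall x, 0 <= (x^T *m A *m x) 0 0.

Definition geodesically_strongly_convex (mu : R) f (C : set 'M[R]_3) : Prop :=
  [/\ geodesically_convex C,
      exists U, [/\ open_SO3 U, C `<=` U & C2_on f U]
    & forall P, C P -> psd (hessian f P - mu%:M)].

Definition is_minimizer f (C : set 'M[R]_3) P : Prop :=
  C P /\ forall Q, C Q -> f P <= f Q.

Definition is_maximum (S : set R) (m : R) : Prop := S m /\ ubound S m.

Definition cot (a : R) : R := cos a / sin a.

Definition closed_ball_SO3 P (r : R) : set 'M[R]_3 :=
  [set Q | SO3 Q /\ dist Q P <= r].

Definition unit_log_toward (Rc P : 'M[R]_3) : 'cV[R]_3 :=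
  (norm2 (vee (logm (P^T *m Rc))))^-1 *: vee (logm (P^T *m Rc)).

End RotationGroup.

(* Main.v *)
(** On the unit quaternions the angle between two rotations is twice the angle
    between lines, and the distance is [d(P, Q) = arccos ((tr (P^T Q) - 1) / 2)]:
    along any curve in SO(3) the derivative of this arccosine is at most the
    speed, and geodesics achieve equality.  Hence [d^2 (., Q)] is the function
    [arccos^2], which extends to a C^2 function beyond 1, of an affine function
    of the matrix.  With [u] the cosine of the angle [t] and [a] the axial
    vector of [Q^T P], the gradient of [d^2 / 2] is [(t / sin t) a] and its
    Hessian has the eigenvalues 1 along [a] and [(t / 2) cot (t / 2)]
    orthogonally to it; the latter is at most 1 and decreases with [t].
    The spherical law of cosines applied to half angles makes the angle at [P]
    between the centre and [R_i] acute whenever [d (R_i, R_c) < d (P, R_c)];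
    so the gradients point outwards at the boundary, and a minimizer at
    distance more than [r0] from the centre could be improved by moving
    towards the centre.  Uniqueness is strict convexity along geodesics. *)

(* The obstacle is the arccosine at the two ends of [-1, 1]. At cosine 1 it has no derivative
   although its square is smooth; the square is therefore continued past 1, which makes each squared
   distance a smooth function on an open set of matrices, where regularity is checked without
   charts. At cosine -1 lies the cut locus, avoided because [rho + r0 < pi]. A rotation determines
   its unit quaternion only up to sign, so distance bounds control only squares of half-angle
   cosines; [rho < pi / 2] excludes the wrong sign, both in the angle argument and in the convexity
   of the ball. The matrices commuting with the cross product by a fixed unit vector form an algebra
   isomorphic to R x C; computing there gives Euler's axis, the exponential and the logarithm in
   closed form. The body frame is not parallel: the covariant derivative of a gradient [g] along [x]
   is its coordinate derivative plus half of [x] cross [g]. This term cancels the asymmetric part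
   and drops out of the quadratic form. *)
Require Import Defs.
From mathcomp Require Import all_boot all_order all_algebra.
From mathcomp Require Import all_classical all_reals all_analysis.
From mathcomp Require Import complex ring lra.

Set Implicit Arguments.
Unset Strict Implicit.
Unset Printing Implicit Defensive.

Import Order.TTheory GRing.Theory Num.Theory.
Import numFieldNormedType.Exports.

Local Open Scope classical_set_scope.
Local Open Scope ring_scope.

(** * Real trigonometry, and the squared arccosine as a C^2 function *)

Section Trigonometry.
Context {R : realType}.
Implicit Types (x y u : R).

Lemma is_derive1_continuous (V : normedModType R) (f : R -> V) x d :
  is_derive x 1 f d -> {for x, continuous f}.
Proof.
by move=> H; apply/differentiable_continuous/derivable1_diffP/ex_derive.
Qed.

Lemma ge0_is_derive1_le (f df : R -> R) a b : a <= b ->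
  (forall x, a <= x <= b -> is_derive x 1 f (df x)) ->
  (forall x, a <= x <= b -> 0 <= df x) -> f a <= f b.
Proof.
move=> ab fdf df0.
have [||c] := @MVT_segment R f df a b ab.
- by move=> x /[!in_itv]/= /andP[/ltW ? /ltW ?]; apply: fdf; apply/andP.
- apply: derivable_within_continuous => x /[!in_itv]/= xab.
  exact: (@ex_derive _ _ _ _ _ _ _ (fdf x xab)).
- move=> /[!in_itv]/= cab E; rewrite -subr_ge0 E mulr_ge0 ?subr_ge0//.
  exact: df0.
Qed.

Lemma sin_le x : 0 <= x -> sin x <= x.
Proof.
move=> x0; rewrite -subr_ge0.
pose f (y : R) := y - sin y.
suff : f 0 <= f x by rewrite /f sin0 subr0.
by apply: (@ge0_is_derive1_le _ (fun y => 1 - cos y)) => // y _;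
  rewrite subr_ge0 cos_le1.
Qed.

Lemma mul_cos_le_sin x : 0 <= x <= pi -> x * cos x <= sin x.
Proof.
move=> /andP[x0 xpi]; rewrite -subr_ge0.
pose f (y : R) := sin y - y * cos y.
suff : f 0 <= f x by rewrite /f sin0 mul0r subr0.
apply: (@ge0_is_derive1_le _ (fun y : R => y * sin y)) => // y /andP[y0 yx].
  by apply: is_derive_eq; rewrite /GRing.scale/=; ring.
by rewrite mulr_ge0// sin_ge0_pi// y0 (le_trans yx).
Qed.

(** With [le_sin3], it squeezes [(sin x - x cos x) / sin^3 x] towards 1/3 as [x] tends to 0. Twice
    this quotient is the second derivative of the squared arccosine at [cos x], whence the value 2/3
    at cosine 1. *)
Lemma sin3_le x : 0 <= x <= pi -> sin x ^+ 3 / 3 <= sin x - x * cos x.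
Proof.
move=> /andP[x0 xpi]; rewrite -subr_ge0.
pose f (y : R) := sin y - y * cos y - sin y ^+ 3 / 3.
suff : f 0 <= f x by rewrite /f sin0 mul0r expr0n/= mul0r !subr0.
apply: (@ge0_is_derive1_le _ (fun y => sin y * (y - sin y * cos y))) => //.
  move=> y _; apply: is_derive_eq; rewrite /GRing.scale/=.
  by field.
move=> y /andP[y0 yx]; have sy : 0 <= sin y.
  by rewrite sin_ge0_pi// y0 (le_trans yx).
rewrite mulr_ge0// subr_ge0 (le_trans _ (sin_le y0))//.
by rewrite ler_piMr// cos_le1.
Qed.

Lemma cos_gt0_half x : 0 <= x < pi / 2 -> 0 < cos x.
Proof.
move=> /andP[x0 x2]; apply: cos_gt0_pihalf; rewrite x2 andbT.
by rewrite (lt_le_trans _ x0)// oppr_lt0 divr_gt0 ?pi_gt0.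
Qed.

Lemma le_sin3 x : 0 <= x < pi / 2 ->
  sin x - x * cos x <= sin x ^+ 3 / (3 * cos x ^+ 2).
Proof.
move=> /andP[x0 xpi]; rewrite -subr_ge0.
pose f (y : R) := sin y ^+ 3 / (3 * cos y ^+ 2) - (sin y - y * cos y).
suff : f 0 <= f x by rewrite /f sin0 mul0r expr0n/= mul0r !subr0.
(* The derivative, grouped into two visibly nonnegative terms, the first by [mul_cos_le_sin]. *)
pose df (y : R) := (sin y / cos y) * (sin y - y * cos y)
   + 2 / 3 * (sin y ^+ 4 / cos y ^+ 3).
apply: (@ge0_is_derive1_le _ df) => // y /andP[y0 yx].
- have cy : 0 < cos y by rewrite cos_gt0_half// y0 (le_lt_trans yx).
  have cy0 : cos y != 0 by rewrite gt_eqF.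
  have c2 : 3 * cos y ^+ 2 != 0 by rewrite mulf_neq0 ?expf_neq0.
  apply: is_derive_eq; rewrite /df /GRing.scale/=.
  by field.
- have y2 : y < pi / 2 by rewrite (le_lt_trans yx).
  have cy : 0 < cos y by rewrite cos_gt0_half// y0.
  have ypi : 0 <= y <= pi.
    by rewrite y0/= (le_trans (ltW y2))// ler_pdivrMr// ler_peMr ?pi_ge0// ler1n.
  have sy : 0 <= sin y by rewrite sin_ge0_pi.
  rewrite addr_ge0// mulr_ge0// ?subr_ge0 ?mul_cos_le_sin//.
  - by rewrite divr_ge0// ltW.
  - by rewrite divr_ge0// exprn_ge0// ltW.
Qed.

Lemma mul_cos_div_sin_nincr x y : 0 < x -> x <= y -> y < pi / 2 ->
  y * cos y / sin y <= x * cos x / sin x.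
Proof.
move=> x0 xy y2; rewrite -lerN2.
pose f (z : R) := - (z * cos z / sin z).
pose df (z : R) := (z - sin z * cos z) / sin z ^+ 2.
apply: (@ge0_is_derive1_le f df) => // z /andP[xz zy].
- have z0 : 0 < z := lt_le_trans x0 xz.
  have sz : sin z != 0.
    by rewrite gt_eqF// sin_gt0_pihalf// z0/= (le_lt_trans zy).
  apply: is_derive_eq; rewrite /df /GRing.scale/=.
  (* The factor [cos^2 + sin^2] is inserted because [field] does not know that it equals 1. *)
  have -> : (z - sin z * cos z) / sin z ^+ 2 =
     (z * (cos z ^+ 2 + sin z ^+ 2) - sin z * cos z) / sin z ^+ 2.
    by rewrite cos2Dsin2 mulr1.
  by field.
- have z0 : 0 < z := lt_le_trans x0 xz.
  rewrite divr_ge0 ?sqr_ge0// subr_ge0 (le_trans _ (sin_le (ltW z0)))//.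
  rewrite ler_piMr ?cos_le1// ltW// sin_gt0_pihalf// z0/=.
  by rewrite (le_lt_trans zy).
Qed.

(** By the mean value theorem the difference quotient at [x] equals [g c] for some [c] at least as
    close to [a] as [x], so it tends to [g a]. This handles the junction at cosine 1, where the
    derivative of the arccosine blows up. *)
Lemma is_derive1_removable (f g : R -> R) (a e : R) : 0 < e ->
  (forall x, `|x - a| < e -> x != a -> is_derive x 1 f (g x)) ->
  {for a, continuous f} -> {for a, continuous g} -> is_derive a 1 f (g a).
Proof.
move=> e0 fg cf cg; apply/is_derive1_caratheodory.
have cfa (x : R) : `|x - a| < e -> {for x, continuous f}.
  move=> xe; have [->//|xa] := eqVneq x a.
  exact/is_derive1_continuous/fg.
have mvt (x : R) : `|x - a| < e -> x != a ->
    exists2 c, `|c - a| <= `|x - a| & f x - f a = g c * (x - a).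
  move=> xe xa; have [xa'|ax|/eqP] := ltgtP x a; last by rewrite (negPf xa).
  - have [||c] := @MVT R f g x a xa'.
    + move=> y /[!in_itv]/= /andP[xy ya]; apply: fg; last by rewrite lt_eqF.
      rewrite (le_lt_trans _ xe)// !ltr0_norm ?subr_lt0// !opprB lerD2l lerN2.
      exact: ltW.
    + apply: continuous_in_subspaceT => y /[!inE]/= /[!in_itv]/= /andP[xy ya].
      apply: cfa; rewrite (le_lt_trans _ xe)// ![`|_ - a|]ler0_norm ?subr_le0//; last exact: ltW.
      by rewrite !opprB lerD2l lerN2.
    + move=> /[!in_itv]/= /andP[xc ca] E; exists c.
        rewrite !ltr0_norm ?subr_lt0// !opprB lerD2l lerN2.
        exact: ltW.
      by rewrite -opprB E -mulrN opprB.
  - have [||c] := @MVT R f g a x ax.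
    + move=> y /[!in_itv]/= /andP[ay yx]; apply: fg; last by rewrite gt_eqF.
      by rewrite (le_lt_trans _ xe)// !gtr0_norm ?subr_gt0// lerD2r ltW.
    + apply: continuous_in_subspaceT => y /[!inE]/= /[!in_itv]/= /andP[ay yx].
      apply: cfa; rewrite (le_lt_trans _ xe)// ![`|_ - a|]ger0_norm ?subr_ge0//; last exact: ltW.
      by rewrite lerD2r.
    + move=> /[!in_itv]/= /andP[ac cx] E; exists c => //.
      by rewrite !gtr0_norm ?subr_gt0// lerD2r ltW.
exists (fun z => if z == a then g a else (f z - f a) / (z - a)); split.
- move=> z; case: eqVneq => [->|za]; first by rewrite !subrr mulr0.
  by rewrite divfK// subr_eq0.
- apply/cvgrPdist_le => /= d d0; rewrite eqxx.
  move/cvgrPdist_le : cg => /(_ d d0)/= [r /= r0 rg].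
  exists (Num.min e r); first by rewrite /= lt_min e0.
  move=> z /=; rewrite lt_min distrC => /andP[ze zr].
  case: ifPn => [_|za]; first by rewrite subrr normr0 ltW.
  have [c ca ->] := mvt z ze za.
  rewrite mulfK ?subr_eq0//; apply: rg => /=.
  by rewrite distrC (le_lt_trans ca).
- by rewrite eqxx.
Qed.

Lemma continuous1_of_lipschitz (f : R -> R) :
  (forall u, 2^-1 < u < 2 -> `|f u - f 1| <= 8 * `|u - 1|) ->
  {for 1, continuous f}.
Proof.
move=> fL; apply/cvgrPdist_le => /= d d0.
exists (Num.min 2^-1 (d / 8)).
  by rewrite /= lt_min invr_gt0 ltr0n divr_gt0.
move=> z /=; rewrite lt_min => /andP[]; rewrite distrC => z1 zd.
rewrite distrC (le_trans (fL _ _))//.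
  by move: z1; rewrite ltr_norml; lra.
by rewrite mulrC -ler_pdivlMr// ltW.
Qed.

Lemma itv_acos u : -1 <= u <= 1 -> 0 <= acos u <= pi.
Proof. by move=> u1; rewrite acos_ge0// acos_lepi. Qed.

Lemma cos_acos u : -1 <= u <= 1 -> cos (acos u) = u.
Proof. by move=> u1; rewrite acosK. Qed.

Lemma acos_cos x : 0 <= x <= pi -> acos (cos x) = x.
Proof. by move=> x1; rewrite cosK. Qed.

Lemma acos_lt u v : -1 <= u <= 1 -> -1 <= v <= 1 -> (acos u < acos v) = (v < u).
Proof.
move=> u1 v1; rewrite -[in RHS](cos_acos u1) -[in RHS](cos_acos v1).
by rewrite ltr_cos// in_itv/= itv_acos.
Qed.

Lemma acos_le u v : -1 <= u <= 1 -> -1 <= v <= 1 -> (acos u <= acos v) = (v <= u).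
Proof. by move=> u1 v1; rewrite !leNgt acos_lt. Qed.

Lemma sin_acos_gt0 u : -1 < u < 1 -> 0 < sin (acos u).
Proof.
move=> /andP[u0 u1]; rewrite sin_gt0_pi// acos_gt0 ?acos_ltpi//.
- by rewrite u0 ltW.
- by rewrite ltW.
Qed.

Lemma sin_acos2 u : -1 <= u <= 1 -> sin (acos u) ^+ 2 = 1 - u ^+ 2.
Proof. by move=> u1; rewrite sin2cos2 cos_acos. Qed.

Lemma is_derive1_acos_sin u : -1 < u < 1 ->
  is_derive u 1 acos (- (sin (acos u))^-1).
Proof.
move=> u1; rewrite sin_acos; first exact: is_derive1_acos.
by case/andP: u1 => ? ?; rewrite !ltW.
Qed.

Lemma acos_lt_half u : 0 < u <= 1 -> 0 <= acos u < pi / 2.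
Proof.
move=> /andP[u0 u1]; have u1' : -1 <= u <= 1.
  by rewrite u1 andbT (le_trans _ (ltW u0))// lerN10.
by rewrite acos_ge0//= -acos0 acos_lt// lerN10 ler01.
Qed.

(* [cangle2], the square of the angle as a function of its cosine, is
   continued beyond [u = 1] by its Taylor polynomial at 1, so that it is of
   class C^2 on ]-1, +oo[. *)
Definition cangle2 u : R :=
  if u < 1 then acos u ^+ 2 else - 2 * (u - 1) + (u - 1) ^+ 2 / 3.

Definition dcangle2 u : R :=
  if u < 1 then - 2 * acos u / sin (acos u) else - 2 + 2 / 3 * (u - 1).

Definition ddcangle2 u : R :=
  if u < 1 then 2 * (sin (acos u) - acos u * cos (acos u)) / sin (acos u) ^+ 3
  else 2 / 3.

Lemma cangle2E u : u <= 1 -> cangle2 u = acos u ^+ 2.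
Proof.
rewrite le_eqVlt => /predU1P[->|u1]; last by rewrite /cangle2 u1.
by rewrite /cangle2 ltxx acos1 subrr mulr0 expr0n/= mul0r addr0.
Qed.

Lemma itvoo_cc u : -1 < u < 1 -> -1 <= u <= 1.
Proof. by move=> /andP[? ?]; rewrite !ltW. Qed.

Lemma near_lt1 u : -1 < u < 1 -> \forall z \near u, z < 1.
Proof. by case/andP => _; exact: lt_nbhsl. Qed.

Lemma near_gt1 u : 1 < u -> \forall z \near u, 1 < z.
Proof. exact: lt_nbhsr. Qed.

Lemma is_derive1_near (f g : R -> R) x d :
  (\forall z \near x, f z = g z) -> is_derive x 1 g d -> is_derive x 1 f d.
Proof.
move=> fg gd; apply: (@near_eq_is_derive _ _ _ g) => //.
by near=> z; rewrite (near fg z).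
Unshelve. all: by end_near. Qed.

Lemma is_derive1_cangle2_lt1 u : -1 < u < 1 ->
  is_derive u 1 cangle2 (dcangle2 u).
Proof.
move=> u1; have := is_derive1_acos_sin u1.
have s0 := sin_acos_gt0 u1.
move=> da; apply: (@is_derive1_near _ (fun z => acos z ^+ 2)).
  by apply: filterS (near_lt1 u1) => z z1; rewrite /cangle2 z1.
apply: is_derive_eq; rewrite /dcangle2; case/andP: (u1) => _ ->.
by rewrite /GRing.scale/=; field; rewrite gt_eqF.
Qed.

Lemma is_derive1_dcangle2_lt1 u : -1 < u < 1 ->
  is_derive u 1 dcangle2 (ddcangle2 u).
Proof.
move=> u1; have da := is_derive1_acos_sin u1.
have s0 := sin_acos_gt0 u1.
have s1 : sin (acos u) != 0 by rewrite gt_eqF.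
apply: (@is_derive1_near _ (fun z => - 2 * acos z / sin (acos z))).
  by apply: filterS (near_lt1 u1) => z z1; rewrite /dcangle2 z1.
have ds : is_derive u 1 (fun z => sin (acos z))
    (cos (acos u) * - (sin (acos u))^-1).
  by apply: (@is_derive1_comp _ sin acos).
apply: is_derive_eq; rewrite /ddcangle2; case/andP: (u1) => _ ->.
by rewrite /GRing.scale/=; field; rewrite s1.
Qed.

Lemma continuous_ddcangle2_lt1 u : -1 < u < 1 -> {for u, continuous ddcangle2}.
Proof.
move=> u1; have da := is_derive1_acos_sin u1.
have s0 := sin_acos_gt0 u1.
have s1 : sin (acos u) != 0 by rewrite gt_eqF.
have ds : is_derive u 1 (fun z => sin (acos z))
    (cos (acos u) * - (sin (acos u))^-1).
  by apply: (@is_derive1_comp _ sin acos).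
have dc : is_derive u 1 (fun z => cos (acos z))
    (- sin (acos u) * - (sin (acos u))^-1).
  by apply: (@is_derive1_comp _ cos acos).
have s3 : sin (acos u) ^+ 3 != 0 by rewrite expf_neq0.
have [d D] : exists d, is_derive u 1 (fun z : R =>
    2 * (sin (acos z) - acos z * cos (acos z)) / sin (acos z) ^+ 3) d.
  by eexists; apply: is_derive_eq.
apply: is_derive1_continuous (is_derive1_near _ D).
by apply: filterS (near_lt1 u1) => z z1; rewrite /ddcangle2 z1.
Qed.

Lemma dcangle2_bound u : 0 < u < 1 -> - 2 / u <= dcangle2 u <= - 2.
Proof.
move=> u1; have u1' : -1 < u < 1 by lra.
have s0 := sin_acos_gt0 u1'.
have [u0 _] := andP u1.
have a2 : 0 <= acos u < pi / 2 by apply: acos_lt_half; lra.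
rewrite /dcangle2; case/andP: (u1) => _ ->.
apply/andP; split.
- rewrite -mulrA !mulNr lerN2 ler_pM2l// ler_pdivrMr// mulrC ler_pdivlMr//.
  rewrite -{2}(@cos_acos u) ?itvoo_cc//; apply: mul_cos_le_sin.
  by rewrite itv_acos// itvoo_cc.
- rewrite -mulrA mulNr lerN2 ler_peMr// ler_pdivlMr// mul1r sin_le//.
  by case/andP: a2.
Qed.

Lemma ddcangle2_bound u : 0 < u < 1 ->
  2 / 3 <= ddcangle2 u <= 2 / 3 / u ^+ 2.
Proof.
move=> u1; have u1' : -1 < u < 1 by lra.
have s0 := sin_acos_gt0 u1'.
have s3 : 0 < sin (acos u) ^+ 3 by rewrite exprn_gt0.
have [u0 _] := andP u1.
have a2 : 0 <= acos u < pi / 2 by apply: acos_lt_half; lra.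
have L := sin3_le (itv_acos (itvoo_cc u1')).
have U := le_sin3 a2.
rewrite /ddcangle2; case/andP: (u1) => _ ->.
rewrite -!mulrA !ler_pM2l//; apply/andP; split.
- by rewrite ler_pdivlMr// mulrC.
- rewrite ler_pdivrMr// (le_trans U)// cos_acos ?itvoo_cc//.
  by rewrite mulrC invfM.
Qed.

Lemma continuous_cangle2_1 : {for 1, continuous cangle2}.
Proof.
apply: continuous1_of_lipschitz => u u2.
rewrite [cangle2 1]cangle2E// acos1 expr0n/= subr0.
have [u1|u1] := ltP u 1; last first.
  rewrite /cangle2 ltNge u1/= (ger0_norm (_ : 0 <= u - 1)) ?subr_ge0//.
  by rewrite ler_norml; nra.
have u0 : 0 < u < 1 by lra.
have u0' : -1 < u < 1 by lra.
rewrite cangle2E ?ltW// ger0_norm ?sqr_ge0// ltr0_norm ?subr_lt0//.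
have := mul_cos_le_sin (itv_acos (itvoo_cc u0')).
have := sin_acos2 (itvoo_cc u0').
rewrite cos_acos ?itvoo_cc//.
have := acos_ge0 (itvoo_cc u0').
have := sin_acos_gt0 u0'.
set t := acos u; set s := sin t => s0 t0 s2 tus.
(* From [t u <= s] and [u > 1/2]. Then [t^2 <= 4 (1 - u^2) <= 8 (1 - u)], the origin of the
   Lipschitz constant 8. *)
have t2s : t <= 2 * s by nra.
have : t ^+ 2 <= 4 * s ^+ 2 by nra.
by rewrite s2; nra.
Qed.

Lemma continuous_dcangle2_1 : {for 1, continuous dcangle2}.
Proof.
apply: continuous1_of_lipschitz => u u2.
rewrite [dcangle2 1]/dcangle2 ltxx subrr mulr0 addr0.
have [u1|u1] := ltP u 1; last first.
  rewrite /dcangle2 ltNge u1/= (ger0_norm (_ : 0 <= u - 1)) ?subr_ge0//.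
  by rewrite ler_norml; lra.
have u0 : 0 < u < 1 by lra.
have := dcangle2_bound u0.
rewrite (ltr0_norm (_ : u - 1 < 0)) ?subr_lt0// => /andP[L U].
rewrite ler_norml; apply/andP; split; last by lra.
have : u^-1 <= 1 + 2 * (1 - u).
  rewrite -[u^-1]mul1r ler_pdivrMr; nra.
by move: L; rewrite mulNr; nra.
Qed.

Lemma continuous_ddcangle2_1 : {for 1, continuous ddcangle2}.
Proof.
apply: continuous1_of_lipschitz => u u2.
rewrite [ddcangle2 1]/ddcangle2 ltxx.
have [u1|u1] := ltP u 1; last first.
  by rewrite /ddcangle2 ltNge u1/= subrr normr0 mulr_ge0.
have u0 : 0 < u < 1 by lra.
have := ddcangle2_bound u0.
rewrite (ltr0_norm (_ : u - 1 < 0)) ?subr_lt0// => /andP[L U].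
rewrite ler_norml; apply/andP; split; first by lra.
have : (u ^+ 2)^-1 <= 1 + 8 * (1 - u).
  rewrite -[(_ ^+ 2)^-1]mul1r ler_pdivrMr; last by nra.
  (* The factorization shows the excess over 1 to be positive for [1/2 < u < 1]. *)
  have -> : (1 + 8 * (1 - u)) * u ^+ 2 =
    1 + (1 - u) * (2^-1 + (u - 2^-1) * (3 + 8 * u)) by field.
  rewrite lerDl mulr_ge0 ?subr_ge0 ?ltW//.
  by rewrite addr_gt0 ?invr_gt0// mulr_gt0; lra.
by move: U; nra.
Qed.

Lemma is_derive1_cangle2 u : -1 < u -> is_derive u 1 cangle2 (dcangle2 u).
Proof.
move=> u0.
have gt1 (z : R) : 1 < z -> is_derive z 1 cangle2 (dcangle2 z).
  move=> z1; apply: (@is_derive1_near _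
      (fun z => - 2 * (z - 1) + (z - 1) ^+ 2 / 3)).
    by apply: filterS (near_gt1 z1) => y y1; rewrite /cangle2 ltNge ltW.
  apply: is_derive_eq; rewrite /dcangle2 ltNge ltW//= /GRing.scale/=.
  by field.
have [u1|/gt1//|->] := ltgtP u 1; first by apply: is_derive1_cangle2_lt1; lra.
apply: (@is_derive1_removable _ _ _ 1) => //; last exact: continuous_dcangle2_1.
  move=> z; rewrite ltr_norml => z1 z1'.
  have [u1|/gt1//|/eqP] := ltgtP z 1; last by rewrite (negPf z1').
  by apply: is_derive1_cangle2_lt1; lra.
exact: continuous_cangle2_1.
Qed.

Lemma is_derive1_dcangle2 u : -1 < u -> is_derive u 1 dcangle2 (ddcangle2 u).
Proof.
move=> u0.
have gt1 (z : R) : 1 < z -> is_derive z 1 dcangle2 (ddcangle2 z).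
  move=> z1; apply: (@is_derive1_near _
      (fun z => - 2 + 2 / 3 * (z - 1))).
    by apply: filterS (near_gt1 z1) => y y1; rewrite /dcangle2 ltNge ltW.
  apply: is_derive_eq; rewrite /ddcangle2 ltNge ltW//= /GRing.scale/=.
  by field.
have [u1|/gt1//|->] := ltgtP u 1; first by apply: is_derive1_dcangle2_lt1; lra.
apply: (@is_derive1_removable _ _ _ 1) => //; last exact: continuous_ddcangle2_1.
  move=> z; rewrite ltr_norml => z1 z1'.
  have [u1|/gt1//|/eqP] := ltgtP z 1; last by rewrite (negPf z1').
  by apply: is_derive1_dcangle2_lt1; lra.
exact: continuous_dcangle2_1.
Qed.

Lemma continuous_ddcangle2 u : -1 < u -> {for u, continuous ddcangle2}.
Proof.
move=> u0; have [u1|u1|->] := ltgtP u 1; last exact: continuous_ddcangle2_1.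
  by apply: continuous_ddcangle2_lt1; lra.
apply: (@is_derive1_continuous _ _ _ 0).
apply: (@is_derive1_near _ (cst (2 / 3))) => //.
by apply: filterS (near_gt1 u1) => y y1; rewrite /ddcangle2 ltNge ltW.
Qed.

(** Continuity at the endpoints included, as the inverse of the continuous injective [cos] on
    [[0, pi]]. *)
Lemma within_continuous_acos : {within `[(-1 : R), 1], continuous acos}.
Proof.
have := @segment_can_ge_continuous R 0 pi cos acos (@pi_ge0 R).
rewrite cos0 cospi; apply; last by move=> x; exact: cosK.
by apply: continuous_subspaceT => x; exact: continuous_cos.
Qed.

Lemma acos_continuity u e : -1 <= u <= 1 -> 0 < e ->
  exists2 d, 0 < d & forall w, -1 <= w <= 1 -> `|w - u| < d ->
    `|acos w - acos u| <= e.
Proof.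
move=> u1 e0; have /subspace_continuousP := within_continuous_acos.
have uI : `[(-1 : R), 1]%classic u by rewrite /= in_itv.
move=> /(_ u uI)/cvgrPdist_le/(_ e e0)[d /= d0 dH]; exists d => // w w1 wu.
by rewrite distrC; apply: dH; rewrite /= ?in_itv//= distrC.
Qed.

(* The chain rule fails for [acos] at the endpoints of [-1, 1]; scaling the
   argument by [l < 1] avoids them. *)
Lemma acosB_le_scaled u v L : -1 <= u <= 1 -> -1 <= v <= 1 ->
  (forall l : R, 0 < l < 1 -> acos (l * u) - acos (l * v) <= L) ->
  acos u - acos v <= L.
Proof.
move=> u1 v1 H; apply/ler_addgt0Pr => e e0.
have e2 : 0 < e / 2 by rewrite divr_gt0.
have [d d0 dH] := acos_continuity u1 e2.
have [d' d'0 d'H] := acos_continuity v1 e2.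
pose m := Num.min 1 (Num.min d d') / 2.
have m0 : 0 < m by rewrite divr_gt0// !lt_min ltr01 d0.
have [m1 md md'] : [/\ m < 1, m < d & m < d'].
  have : 0 < Num.min 1 (Num.min d d') by rewrite !lt_min ltr01 d0.
  have : Num.min 1 (Num.min d d') <= 1 by rewrite ge_min lexx.
  have : Num.min 1 (Num.min d d') <= d by rewrite !ge_min lexx orbT.
  have : Num.min 1 (Num.min d d') <= d' by rewrite !ge_min lexx !orbT.
  by rewrite /m; split; lra.
have l01 : 0 < 1 - m < 1 by lra.
have bound w : -1 <= w <= 1 ->
    -1 <= (1 - m) * w <= 1 /\ `|(1 - m) * w - w| <= m.
  by move=> w1; split; [nra | rewrite ler_norml; nra].
have [bu1 bu2] := bound u u1; have [bv1 bv2] := bound v v1.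
have := H _ l01.
have := dH _ bu1 (le_lt_trans bu2 md).
have := d'H _ bv1 (le_lt_trans bv2 md').
by rewrite !ler_norml => /andP[? ?] /andP[? ?] ?; lra.
Qed.

End Trigonometry.

(** * Coordinate formulas in dimension 3 *)

Section Coordinates.
Context {R : realType}.
Implicit Types (x y n : 'cV[R]_3) (A P Q X : 'M[R]_3) (a b c : R).

Lemma sum3E (V : nmodType) (F : 'I_3 -> V) : \sum_i F i = F 0 + F 1 + F 2.
Proof.
by rewrite !big_ord_recl big_ord0 addr0 addrA; congr (_ + _ + _);
  congr F; apply: val_inj.
Qed.

Lemma ord3_ind (p : 'I_3 -> Prop) : p 0 -> p 1 -> p 2 -> forall i, p i.
Proof.
move=> p0 p1 p2 [[|[|[|//]]] i].
- by rewrite (_ : Ordinal i = 0)//; apply: val_inj.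
- by rewrite (_ : Ordinal i = 1)//; apply: val_inj.
- by rewrite (_ : Ordinal i = 2)//; apply: val_inj.
Qed.

Lemma ord3D : ((0 + 1 : 'I_3) = 1) * ((0 + 2 : 'I_3) = 2) *
  ((1 + 1 : 'I_3) = 2) * ((1 + 2 : 'I_3) = 0) * ((2 + 1 : 'I_3) = 0) *
  ((2 + 2 : 'I_3) = 1).
Proof. by do !split; apply: val_inj. Qed.

Lemma mx3P A P : 
  [/\ A 0 0 = P 0 0, A 0 1 = P 0 1 & A 0 2 = P 0 2] ->
  [/\ A 1 0 = P 1 0, A 1 1 = P 1 1 & A 1 2 = P 1 2] ->
  [/\ A 2 0 = P 2 0, A 2 1 = P 2 1 & A 2 2 = P 2 2] -> A = P.
Proof.
move=> [? ? ?] [? ? ?] [? ? ?]; apply/matrixP.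
by elim/ord3_ind; elim/ord3_ind.
Qed.

Lemma cV3P x y : x 0 0 = y 0 0 -> x 1 0 = y 1 0 -> x 2 0 = y 2 0 -> x = y.
Proof.
by move=> x0 x1 x2; apply/matrixP => i j; rewrite (ord1 j); elim/ord3_ind: i.
Qed.

Lemma crossE x y : (cross x y 0 0 = x 1 0 * y 2 0 - x 2 0 * y 1 0) *
  (cross x y 1 0 = x 2 0 * y 0 0 - x 0 0 * y 2 0) *
  (cross x y 2 0 = x 0 0 * y 1 0 - x 1 0 * y 0 0).
Proof. by rewrite /cross !mxE !ord3D. Qed.

Lemma hatE x : (hat x 0 0 = 0) * (hat x 0 1 = - x 2 0) * (hat x 0 2 = x 1 0) *
  ((hat x 1 0 = x 2 0) * (hat x 1 1 = 0) * (hat x 1 2 = - x 0 0)) *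
  ((hat x 2 0 = - x 1 0) * (hat x 2 1 = x 0 0) * (hat x 2 2 = 0)).
Proof. by rewrite /hat; do !split; rewrite mxE !crossE !mxE /=; ring. Qed.

Lemma veeE A : (vee A 0 0 = A 2 1) * (vee A 1 0 = A 0 2) * (vee A 2 0 = A 1 0).
Proof. by rewrite /vee !mxE !ord3D. Qed.

Lemma skew_partE A i j : skew_part A i j = 2^-1 * (A i j - A j i).
Proof. by rewrite /skew_part !mxE. Qed.

Lemma dotE x y : dot x y = x 0 0 * y 0 0 + x 1 0 * y 1 0 + x 2 0 * y 2 0.
Proof. by rewrite /dot mxE sum3E !mxE. Qed.

Lemma mulmx3E m p (A : 'M[R]_(m, 3)) (P : 'M[R]_(3, p)) i j :
  (A *m P) i j = A i 0 * P 0 j + A i 1 * P 1 j + A i 2 * P 2 j.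
Proof. by rewrite mxE sum3E. Qed.

Lemma tr3E A : \tr A = A 0 0 + A 1 1 + A 2 2.
Proof. by rewrite /mxtrace sum3E. Qed.

Lemma scalar3E a : ((a%:M : 'M[R]_3) 0 0 = a) * ((a%:M : 'M[R]_3) 0 1 = 0) *
  ((a%:M : 'M[R]_3) 0 2 = 0) * ((a%:M : 'M[R]_3) 1 0 = 0) *
  ((a%:M : 'M[R]_3) 1 1 = a) * ((a%:M : 'M[R]_3) 1 2 = 0) *
  ((a%:M : 'M[R]_3) 2 0 = 0) * ((a%:M : 'M[R]_3) 2 1 = 0) *
  ((a%:M : 'M[R]_3) 2 2 = a).
Proof. by rewrite !mxE /=. Qed.

Lemma outerE x y i j : (x *m y^T) i j = x i 0 * y j 0.
Proof. by rewrite mxE big_ord1 mxE. Qed.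

Definition axial A := vee (skew_part A).

Lemma axialE A : (axial A 0 0 = 2^-1 * (A 2 1 - A 1 2)) *
  (axial A 1 0 = 2^-1 * (A 0 2 - A 2 0)) * (axial A 2 0 = 2^-1 * (A 1 0 - A 0 1)).
Proof. by rewrite /axial !veeE !skew_partE. Qed.

Definition coordE := (outerE, mulmx3E, tr3E, scalar3E, crossE, hatE, axialE, veeE, dotE).

Lemma mxaddE m p (A P : 'M[R]_(m, p)) i j : (A + P) i j = A i j + P i j.
Proof. by rewrite mxE. Qed.

Lemma mxoppE m p (A : 'M[R]_(m, p)) i j : (- A) i j = - A i j.
Proof. by rewrite mxE. Qed.

Lemma mxscaleE m p a (A : 'M[R]_(m, p)) i j : (a *: A) i j = a * A i j.
Proof. by rewrite mxE. Qed.

Lemma mxtrE m p (A : 'M[R]_(m, p)) i j : A^T j i = A i j.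
Proof. by rewrite mxE. Qed.

Lemma mx0E m p (i : 'I_m) (j : 'I_p) : (0 : 'M[R]_(m, p)) i j = 0.
Proof. by rewrite mxE. Qed.

Definition dentE := (mxaddE, mxoppE, mxscaleE, mxtrE, mx0E).

Lemma det3E A : \det A = A 0 0 * (A 1 1 * A 2 2 - A 1 2 * A 2 1)
  - A 0 1 * (A 1 0 * A 2 2 - A 1 2 * A 2 0)
  + A 0 2 * (A 1 0 * A 2 1 - A 1 1 * A 2 0).
Proof.
rewrite (expand_det_row _ 0) sum3E /cofactor.
rewrite !(expand_det_row _ ord0) !big_ord_recl !big_ord0 /cofactor !det_mx11 !mxE /=.
(* Entries indexed by natural numbers make ordinals that differ only by their proofs syntactically
   equal, as [ring] requires. *)
have [B AE] : exists B : nat -> nat -> R, forall i j : 'I_3, A i j = B i j.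
  by exists (fun i j => A (inord i) (inord j)) => i j; rewrite !inord_val.
rewrite !AE /= /bump /= !modn_small//=.
ring.
Qed.

End Coordinates.

Ltac mx3_ring := apply: mx3P; split; rewrite ?(coordE, dentE); ring.
Ltac cV3_ring := apply: cV3P; rewrite ?(coordE, dentE); ring.

(** * Cross-product matrices and the matrices commuting with one of them *)

Section LinearAlgebra.
Context {R : realType}.
Implicit Types (x y n : 'cV[R]_3) (A P Q X : 'M[R]_3) (a b c : R).

Lemma hatZ a x : hat (a *: x) = a *: hat x.
Proof. mx3_ring. Qed.

Lemma hat0 : hat (0 : 'cV[R]_3) = 0.
Proof. mx3_ring. Qed.

Lemma hat_tr x : (hat x)^T = - hat x.
Proof. mx3_ring. Qed.

Lemma hat_mul x y : hat x *m y = cross x y.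
Proof. cV3_ring. Qed.

Lemma mul_hat_tr x y : y^T *m hat x = - (cross x y)^T.
Proof. by rewrite -[hat x]opprK -hat_tr mulmxN -trmx_mul hat_mul. Qed.

Lemma crossxx x : cross x x = 0.
Proof. cV3_ring. Qed.

Lemma veeK x : vee (hat x) = x.
Proof. cV3_ring. Qed.

Lemma axial_hat x : axial (hat x) = x.
Proof. apply: cV3P; rewrite ?(coordE, dentE); by field. Qed.

Lemma axialD A P : axial (A + P) = axial A + axial P.
Proof. cV3_ring. Qed.

Lemma axial_tr A : axial A^T = - axial A.
Proof. cV3_ring. Qed.

Lemma axial_sym_skew A : A = 2^-1 *: (A + A^T) + hat (axial A).
Proof. apply: mx3P; split; rewrite ?(coordE, dentE); by field. Qed.

Lemma hat_mul_hat x y : hat x *m hat y = y *m x^T - (dot x y)%:M.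
Proof. mx3_ring. Qed.

Lemma tr_mul_hat A x : \tr (A *m hat x) = - 2 * dot (axial A) x.
Proof. rewrite ?(coordE, dentE); by field. Qed.

(** The matrix form of the rule that the triple product of [A x], [A y], [A z] is [\det A] times
    that of [x], [y], [z]. For a rotation fixing [x] it yields commutation with [hat x]. *)
Lemma hat_cofactor A x : A^T *m hat (A *m x) *m A = \det A *: hat x.
Proof. by apply: mx3P; split; rewrite det3E ?(coordE, dentE); ring. Qed.

(* Multiplication by [a] on the axis [n] and by the complex number [b + i c]
   on the plane orthogonal to the unit vector [n]. *)
Definition axrot a b c n : 'M[R]_3 :=
  a *: (n *m n^T) + b *: (1%:M - n *m n^T) + c *: hat n.

Lemma hat_sqr n : dot n n = 1 -> hat n *m hat n = n *m n^T - 1%:M.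
Proof. by move=> n1; rewrite hat_mul_hat n1. Qed.

Lemma dot_mx x y : x^T *m y = (dot x y)%:M.
Proof. exact: mx11_scalar. Qed.

Lemma dotC x y : dot x y = dot y x.
Proof. by rewrite !coordE; ring. Qed.

Lemma hat_diag n : hat n *m n = 0.
Proof. by rewrite hat_mul crossxx. Qed.

Lemma tr_hat_diag n : n^T *m hat n = 0.
Proof. by rewrite mul_hat_tr crossxx trmx0 oppr0. Qed.

Lemma outerM (x y z w : 'cV[R]_3) : (x *m y^T) *m (z *m w^T) = dot y z *: (x *m w^T).
Proof. by rewrite mulmxA -(mulmxA x) dot_mx mul_mx_scalar scalemxAl. Qed.

(** The projection [n n^T] is idempotent and annihilates [hat n], while the square of [hat n] is
    minus the complementary projection: this is the multiplication table of R x C. *)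
Lemma axrotM a b c a' b' c' n : dot n n = 1 ->
  axrot a b c n *m axrot a' b' c' n =
  axrot (a * a') (b * b' - c * c') (b * c' + c * b') n.
Proof.
move=> n1; rewrite /axrot.
have NN : (n *m n^T) *m (n *m n^T) = n *m n^T by rewrite outerM n1 scale1r.
have NK : (n *m n^T) *m hat n = 0 by rewrite -mulmxA tr_hat_diag mulmx0.
have KN : hat n *m (n *m n^T) = 0 by rewrite mulmxA hat_diag mul0mx.
have KK := hat_sqr n1.
move: (n *m n^T) (hat n) NN NK KN KK => N K NN NK KN KK.
rewrite !(mulmxDl, mulmxDr, mulmxN, mulNmx, =^~scalemxAl, =^~scalemxAr).
rewrite NN NK KN KK !mul1mx !mulmx1.
apply/matrixP => i j; rewrite !mxE; ring.
Qed.

Lemma axrot_tr a b c n : (axrot a b c n)^T = axrot a b (- c) n.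
Proof. by rewrite /axrot; mx3_ring. Qed.

Lemma axrot1 n : axrot 1 1 0 n = 1%:M.
Proof. by rewrite /axrot !scale1r scale0r addr0 addrC subrK. Qed.

Lemma tr_axrot a b c n : dot n n = 1 -> \tr (axrot a b c n) = a + 2 * b.
Proof.
move=> n1.
transitivity (a * dot n n + b * (3 - dot n n)); last by rewrite n1; ring.
by rewrite /axrot ?(coordE, dentE); ring.
Qed.

Lemma axial_axrot a b c n : axial (axrot a b c n) = c *: n.
Proof. by rewrite /axrot; apply: cV3P; rewrite ?(coordE, dentE); field. Qed.

Lemma axrot_axis a b c n : dot n n = 1 -> axrot a b c n *m n = a *: n.
Proof.
move=> n1; rewrite /axrot !mulmxDl -!scalemxAl hat_diag scaler0 addr0.
rewrite mulmxDl mulNmx mul1mx -mulmxA dot_mx n1 mulmx1.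
by rewrite subrr scaler0 addr0.
Qed.

(** If [X] commutes with [hat n] for a unit [n], the left side is [X (n n^T - 1)], and the identity
    determines the symmetric part of [X]. *)
Lemma hat_mul_mx_hat X n : hat n *m X *m hat n =
  - ((dot n n * \tr X - dot n (X *m n))%:M - \tr X *: (n *m n^T)
     + X^T *m (n *m n^T) + (n *m n^T) *m X^T - dot n n *: X^T).
Proof. by apply: mx3P; split; rewrite ?(coordE, dentE); ring. Qed.

Lemma cross_hat x y : hat x *m hat y - hat y *m hat x = hat (cross x y).
Proof. by mx3_ring. Qed.

Lemma cross_eq0 n x : dot n n = 1 -> cross n x = 0 -> x = dot n x *: n.
Proof.
move=> n1 nx; have : hat n *m (hat n *m x) = 0 by rewrite [X in _ *m X]hat_mul nx mulmx0.
rewrite mulmxA hat_sqr// mulmxBl mul1mx -mulmxA dot_mx mul_mx_scalar.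
by move/eqP; rewrite subr_eq0 => /eqP.
Qed.

(** Both [X] and its transpose preserve the axis, the kernel of [hat n]. The symmetric part then
    follows from [hat_mul_mx_hat]; the skew part is a multiple of [hat n], since its axial vector
    has zero cross product with [n]. *)
Lemma commute_hat X n : dot n n = 1 -> X *m hat n = hat n *m X ->
  exists a b c, X = axrot a b c n.
Proof.
have main Y : dot n n = 1 -> Y *m hat n = hat n *m Y ->
    Y *m n = dot n (Y *m n) *: n.
  move=> n1 Yn; apply: cross_eq0 => //.
  by rewrite -hat_mul mulmxA -Yn -mulmxA hat_diag mulmx0.
move=> n1 Xn; have XTn : X^T *m hat n = hat n *m X^T.
  have /(congr1 trmx) := Xn; rewrite !trmx_mul hat_tr mulNmx mulmxN.
  by move/oppr_inj.
have E := main _ n1 Xn; have ET := main _ n1 XTn.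
have aT : dot n (X^T *m n) = dot n (X *m n) by rewrite ?(coordE, dentE); ring.
set a := dot n (X *m n) in E aT; rewrite aT in ET.
have NX : (n *m n^T) *m X^T = a *: (n *m n^T).
  by rewrite -mulmxA -trmx_mul E linearZ/= scalemxAr.
have XN : X^T *m (n *m n^T) = a *: (n *m n^T) by rewrite mulmxA ET scalemxAl.
have XN' : X *m (n *m n^T) = a *: (n *m n^T) by rewrite mulmxA E scalemxAl.
have := hat_mul_mx_hat X n.
rewrite -Xn -mulmxA hat_sqr// mulmxBr mulmx1 XN' NX XN n1 -/a => S.
have wn : cross n (axial X) = 0.
  rewrite -[cross _ _]veeK -cross_hat.
  have Xw : hat (axial X) = 2^-1 *: (X - X^T).
    by apply: mx3P; split; rewrite ?(coordE, dentE); field.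
  by rewrite Xw -scalemxAr -scalemxAl !mulmxBr !mulmxBl Xn XTn subrr -hat0 veeK.
have W : hat (axial X) = dot n (axial X) *: hat n.
  by rewrite {1}(cross_eq0 n1 wn) hatZ.
(* [a] is the eigenvalue on the axis; the trace [a + 2 b] gives the second coefficient and the axial
   vector [c n] the third. *)
exists a, ((\tr X - a) / 2), (dot n (axial X)).
rewrite {1}[X]axial_sym_skew /axrot W; congr (_ + _).
have S' : X + X^T = a *: (n *m n^T) + ((1 * \tr X - a)%:M
    - \tr X *: (n *m n^T) + a *: (n *m n^T) + a *: (n *m n^T)).
  rewrite -[X in X + _](subKr (a *: (n *m n^T))) S scale1r.
  apply/matrixP => i j; rewrite !mxE; ring.
rewrite S'; apply: mx3P; split; rewrite ?(coordE, dentE); by field.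
Qed.

End LinearAlgebra.

(** * Rotations: Euler's axis, angle and quaternions *)

Section Rotations.
Context {R : realType}.
Implicit Types (x y n m : 'cV[R]_3) (A P Q X : 'M[R]_3) (a b c t : R).

Lemma SO3_tr_mul P : SO3 P -> P^T *m P = 1%:M.
Proof. by case. Qed.

Lemma SO3_mul_tr P : SO3 P -> P *m P^T = 1%:M.
Proof. by case=> PTP _; apply: mulmx1C. Qed.

Lemma SO3_tr P : SO3 P -> SO3 P^T.
Proof. by move=> SP; split; rewrite ?trmxK ?SO3_mul_tr// det_tr; case: SP. Qed.

Lemma SO3M P Q : SO3 P -> SO3 Q -> SO3 (P *m Q).
Proof.
move=> [PP dP] [QQ dQ]; split; last by rewrite det_mulmx dP dQ mulr1.
by rewrite trmx_mul mulmxA -(mulmxA Q^T) PP mulmx1.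
Qed.

Lemma det_axrot a b c n : dot n n = 1 -> \det (axrot a b c n) = a * (b ^+ 2 + c ^+ 2).
Proof.
move=> n1; transitivity ((a * dot n n + b * (1 - dot n n)) * (b ^+ 2 + c ^+ 2 * dot n n)).
  by rewrite det3E /axrot ?(coordE, dentE); ring.
by rewrite n1; ring.
Qed.

Lemma axrotN a b c n : axrot a b c (- n) = axrot a b (- c) n.
Proof. by rewrite /axrot; mx3_ring. Qed.

Definition rot t n := axrot 1 (cos t) (sin t) n.

Lemma SO3_rot t n : dot n n = 1 -> SO3 (rot t n).
Proof.
move=> n1; split; last by rewrite det_axrot// cos2Dsin2 mulr1.
rewrite axrot_tr axrotM// mulNr opprK mulr1 -!expr2 cos2Dsin2.
by rewrite mulNr mulrC subrr axrot1.
Qed.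

Lemma rot_commute s t n : dot n n = 1 -> rot s n *m rot t n = rot (s + t) n.
Proof. by move=> n1; rewrite axrotM// mulr1 /rot cosD sinD; congr axrot; ring. Qed.

Lemma dotZl a x y : dot (a *: x) y = a * dot x y.
Proof. by rewrite !dotE !mxscaleE; ring. Qed.

Lemma dotZr a x y : dot x (a *: y) = a * dot x y.
Proof. by rewrite !dotE !mxscaleE; ring. Qed.

Lemma dotDl x y n : dot (x + y) n = dot x n + dot y n.
Proof. by rewrite !dotE !mxaddE; ring. Qed.

Lemma norm2_ge0 x : 0 <= norm2 x.
Proof. exact: sqrtr_ge0. Qed.

Lemma dot_ge0 x : 0 <= dot x x.
Proof. by rewrite dotE !addr_ge0// -expr2 sqr_ge0. Qed.

Lemma norm2_sqr x : norm2 x ^+ 2 = dot x x.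
Proof. by rewrite sqr_sqrtr// dot_ge0. Qed.

Lemma norm2Z a x : norm2 (a *: x) = `|a| * norm2 x.
Proof.
rewrite /norm2 -sqrtr_sqr -sqrtrM ?sqr_ge0//; congr Num.sqrt.
by rewrite !(coordE, dentE); ring.
Qed.

Lemma norm2_eq0 x : norm2 x = 0 -> x = 0.
Proof.
move=> /(congr1 (fun a => a ^+ 2)); rewrite norm2_sqr expr0n/= dotE.
by move=> x0; apply: cV3P; rewrite mx0E; nra.
Qed.

Lemma norm2_unit n : dot n n = 1 -> norm2 n = 1.
Proof. by rewrite /norm2 => ->; rewrite sqrtr1. Qed.

Lemma dot_normalized x : x != 0 -> dot ((norm2 x)^-1 *: x) ((norm2 x)^-1 *: x) = 1.
Proof.
move=> x0; have nx : norm2 x != 0 by apply: contra_neq x0 => /norm2_eq0.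
by rewrite dotZl dotZr -norm2_sqr; field.
Qed.

Lemma cV3_polar x : exists n, dot n n = 1 /\ x = norm2 x *: n.
Proof.
have [->|x0] := eqVneq x 0.
  exists (delta_mx 0 0); split; first by rewrite dotE !mxE /=; ring.
  by rewrite /norm2 dotE !mxE !mulr0 !addr0 sqrtr0 scale0r.
exists ((norm2 x)^-1 *: x); split; first exact: dot_normalized.
rewrite scalerA divff ?scale1r//.
by apply: contra_neq x0 => /norm2_eq0.
Qed.

Lemma cauchy_schwarz x y : dot x y ^+ 2 <= dot x x * dot y y.
Proof.
rewrite -subr_ge0.
have -> : dot x x * dot y y - dot x y ^+ 2 = dot (cross x y) (cross x y).
  by rewrite !coordE; ring.
exact: dot_ge0.
Qed.

(** Euler's theorem. [\det (P - 1)] equals its own opposite because the dimension is odd, so a unit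
    vector is fixed; [P] commutes with its [hat] by [hat_cofactor], and [commute_hat] gives the
    normal form, where [\det P = 1] reads [b^2 + c^2 = 1]. *)
Lemma rot_exists P : SO3 P ->
  exists t n, [/\ dot n n = 1, 0 <= t <= pi & P = rot t n].
Proof.
move=> SP; have [PP dP] := SP.
have /eqP/det0P[v v0 vP] : \det (P - 1%:M) = 0.
  have : \det (P - 1%:M) = - \det (P - 1%:M).
    rewrite -{1}(SO3_mul_tr SP) -{1}[P]mulmx1 -mulmxBr det_mulmx dP mul1r.
    rewrite -det_tr linearB/= trmxK trmx1 -opprB -scaleN1r detZ.
    by rewrite -signr_odd expr1 mulN1r.
  by move/eqP; rewrite -addr_eq0 -mulr2n mulrn_eq0 => /eqP.
have vT0 : v^T != 0 by apply: contra_neq v0 => /(congr1 trmx); rewrite trmxK trmx0.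
set n := (norm2 v^T)^-1 *: v^T.
have n1 : dot n n = 1 by exact: dot_normalized.
have Pn : P *m n = n.
  move/eqP: vP; rewrite mulmxBr mulmx1 subr_eq0 => /eqP vP.
  have Pv : P *m v^T = v^T.
    by rewrite -[in LHS]vP trmx_mul mulmxA (SO3_mul_tr SP) mul1mx.
  by rewrite /n -scalemxAr Pv.
have Pc : P *m hat n = hat n *m P.
  have := hat_cofactor P n; rewrite Pn dP scale1r => /(congr1 (mulmx P)).
  by rewrite !mulmxA (SO3_mul_tr SP) mul1mx.
have [a [b [c E]]] := commute_hat n1 Pc.
have a1 : a = 1.
  have : dot n (P *m n) = a by rewrite E axrot_axis// dotZr n1 mulr1.
  by rewrite Pn n1.
move: E; rewrite {}a1 => E.
have bc : b ^+ 2 + c ^+ 2 = 1 by rewrite -dP E det_axrot// mul1r.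
have b1 : -1 <= b <= 1 by nra.
have c2 : c ^+ 2 = sin (acos b) ^+ 2 by rewrite sin_acos2//; lra.
(* The angle is taken in [[0, pi]]; if [c] is minus its sine, the axis is reversed. *)
have /eqP : (c - sin (acos b)) * (c + sin (acos b)) = 0 by rewrite -subr_sqr c2 subrr.
rewrite mulf_eq0 subr_eq0 addr_eq0 => /orP[]/eqP cE.
  by exists (acos b), n; split; rewrite ?itv_acos// /rot cos_acos// -cE.
exists (acos b), (- n); split; rewrite ?itv_acos//.
  by rewrite -n1 !dotE !mxoppE; ring.
by rewrite /rot axrotN cos_acos// -cE.
Qed.

(** Cosine of the angle of [P^T Q], whose trace is 1 plus twice this cosine. It is defined for all
    matrices and affine in each argument, which makes its directional derivatives constant. *)
Definition cosang P Q : R := (\tr (P^T *m Q) - 1) / 2.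

Lemma cosangC P Q : cosang P Q = cosang Q P.
Proof. by rewrite /cosang -mxtrace_tr trmx_mul trmxK. Qed.

Lemma cosang_rot t n P Q : dot n n = 1 -> P^T *m Q = rot t n -> cosang P Q = cos t.
Proof. by move=> n1; rewrite /cosang => ->; rewrite tr_axrot//; field. Qed.

Lemma cosang_itv P Q : SO3 P -> SO3 Q -> -1 <= cosang P Q <= 1.
Proof.
move=> SP SQ; have [t [n [n1 _ E]]] := rot_exists (SO3M (SO3_tr SP) SQ).
by rewrite (cosang_rot n1 E) cos_geN1 cos_le1.
Qed.

(* The rotation matrix of the quaternion with real part [w] and vector
   part [x], up to the factor [w^2 + |x|^2]. *)
Definition quat (w : R) x : 'M[R]_3 :=
  (w ^+ 2 - dot x x)%:M + (2 * w) *: hat x + 2 *: (x *m x^T).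

Lemma rot_quat t n : dot n n = 1 -> rot t n = quat (cos (t / 2)) (sin (t / 2) *: n).
Proof.
move=> n1; set u := t / 2.
have -> : rot t n = rot u n *m rot u n by rewrite rot_commute// -splitr.
rewrite axrotM// !mulr1 /axrot /quat dotZl dotZr n1.
have h : cos u ^+ 2 = 1 - sin u ^+ 2 by rewrite cos2sin2.
by apply: mx3P; split; rewrite ?(coordE, dentE); ring: h.
Qed.

(** [w w' - dot x x'] is the real part of the product quaternion, and the trace of [quat] is four
    times the squared real part minus the squared norm. The product itself need not be formed. *)
Lemma tr_quatM w x w' x' : \tr (quat w x *m quat w' x') =
  4 * (w * w' - dot x x') ^+ 2 - (w ^+ 2 + dot x x) * (w' ^+ 2 + dot x' x').
Proof. by rewrite /quat ?(coordE, dentE); ring. Qed.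

(** The spherical law of cosines for half angles: the expression squared is, up to sign, the cosine
    of half the angle of the product. *)
Lemma tr_rotM s n t m : dot n n = 1 -> dot m m = 1 -> \tr (rot s n *m rot t m) =
  4 * (cos (s / 2) * cos (t / 2) - sin (s / 2) * sin (t / 2) * dot n m) ^+ 2 - 1.
Proof.
move=> n1 m1; rewrite !rot_quat// tr_quatM.
have -> : dot (sin (s / 2) *: n) (sin (t / 2) *: m) =
   sin (s / 2) * sin (t / 2) * dot n m by rewrite !dotE !mxscaleE; ring.
have Z u n' : dot n' n' = 1 -> cos u ^+ 2 + dot (sin u *: n') (sin u *: n') = 1.
  move=> n'1; transitivity (cos u ^+ 2 + sin u ^+ 2 * dot n' n').
    by rewrite !dotE !mxscaleE; ring.
  by rewrite n'1 mulr1 cos2Dsin2.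
by rewrite !Z// mulr1.
Qed.

End Rotations.

(** * Entrywise derivatives and limits of matrix functions *)

Section MatrixCalculus.
Context {R : realType}.

Lemma is_derive_congr (V : normedModType R) (f : R -> V) (t : R) d d' :
  is_derive t 1 f d -> d = d' -> is_derive t 1 f d'.
Proof. by move=> H <-. Qed.

Lemma is_derive_mxP m p (c : R -> 'M[R]_(m, p)) (t : R) (D : 'M[R]_(m, p)) :
  (forall i j, is_derive t 1 (fun s => c s i j) (D i j)) <-> is_derive t 1 c D.
Proof.
split=> [H|H].
- have dc : derivable c t 1 by apply/derivable_mxP => i j; apply: ex_derive.
  apply: DeriveDef => //; rewrite derive_mx//; apply/matrixP => i j.
  by rewrite mxE; apply: derive_val.
- move=> i j; have dc : derivable c t 1 by apply: ex_derive.
  have /derivable_mxP/(_ i j) dij := dc.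
  apply: DeriveDef => //.
  have : 'D_1 c t = D by apply: derive_val.
  by rewrite derive_mx// => /matrixP/(_ i j); rewrite mxE.
Qed.

Lemma is_derive_mulmx m p q (c : R -> 'M[R]_(m, p)) (d : R -> 'M[R]_(p, q)) (t : R) C D :
  is_derive t 1 c C -> is_derive t 1 d D ->
  is_derive t 1 (fun s => c s *m d s) (C *m d t + c t *m D).
Proof.
move=> /is_derive_mxP cC /is_derive_mxP dD; apply/is_derive_mxP => i j.
have -> : (fun s => (c s *m d s) i j) = \sum_(k < p) (fun s => c s i k * d s k j).
  by apply/funext => s; rewrite mxE fct_sumE.
have H k : is_derive t 1 (fun s => c s i k * d s k j) (c t i k * D k j + d t k j * C i k).
  have := cC i k; have := dD k j => ? ?; exact: is_derive_eq.
apply: (is_derive_congr (is_derive_sum H)).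
by rewrite !mxE -big_split; apply: eq_bigr => k _ /=; ring.
Qed.

Lemma is_derive_mulmxl m p q (A : 'M[R]_(m, p)) (d : R -> 'M[R]_(p, q)) (t : R) D :
  is_derive t 1 d D -> is_derive t 1 (fun s => A *m d s) (A *m D).
Proof.
move=> dD; have := is_derive_mulmx (is_derive_cst A t 1) dD.
by rewrite mul0mx add0r.
Qed.

Lemma is_derive_mulmxr m p q (A : 'M[R]_(p, q)) (d : R -> 'M[R]_(m, p)) (t : R) D :
  is_derive t 1 d D -> is_derive t 1 (fun s => d s *m A) (D *m A).
Proof.
move=> dD; have := is_derive_mulmx dD (is_derive_cst A t 1).
by rewrite mulmx0 addr0.
Qed.

Lemma mx_entry_le_norm m p (A : 'M[R]_(m, p)) i j : `|A i j| <= `|A|.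
Proof.
rewrite [leRHS]/Num.Def.normr/= mx_normrE.
exact: (le_bigmax _ (fun k : 'I_m * 'I_p => `|A k.1 k.2|) (i, j)).
Qed.

Lemma cvg_mxP T (F : set_system T) {FF : Filter F} m p
    (f : T -> 'M[R]_(m, p)) (A : 'M[R]_(m, p)) :
  (forall i j, f x i j @[x --> F] --> A i j) -> f x @[x --> F] --> A.
Proof.
move=> fA; apply/cvgrPdist_le => e e0; near=> x.
rewrite /Num.Def.normr/= mx_normrE (bigmax_le _ (ltW e0))//= => i _.
rewrite !mxE/=; move: i; near: x; apply: filter_forall => /= i.
by have /cvgrPdist_le := fA i.1 i.2; exact.
Unshelve. all: by end_near. Qed.

Lemma cvg_mx_entry T (F : set_system T) {FF : Filter F} m p
    (f : T -> 'M[R]_(m, p)) (A : 'M[R]_(m, p)) i j :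
  f x @[x --> F] --> A -> f x i j @[x --> F] --> A i j.
Proof.
move=> fA; apply: (@cvg_comp _ _ _ f (fun M : 'M[R]_(m, p) => M i j) _ (nbhs A)) => //.
exact: coord_continuous.
Qed.

End MatrixCalculus.

(** * The matrix exponential and its differential equation *)

Section MatrixExponential.
Context {R : realType}.
Implicit Types (A M : 'M[R]_3) (t : R) (d : nat -> R).

(** With [d k] an entry of [A ^+ k], these are the coefficients of that entry of [expm (t *: A)] as
    a scalar power series in [t]. *)
Definition expcoef d : nat -> R := fun k => d k / k`!%:R.

Lemma is_cvg_expcoef d C b t : 0 <= b -> (forall k, `|d k| <= C * b ^+ k) ->
  cvgn (pseries (expcoef d) t).
Proof.
move=> b0 dC; apply: normed_cvg; rewrite /normed_series_of /=.
have C0 : 0 <= C by have := dC 0%N; rewrite expr0 mulr1; apply: le_trans.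
apply: (@series_le_cvg _ _ (fun k => C * (exp_coeff (b * `|t|) k))).
- by [].
- by move=> k; rewrite mulr_ge0// exp_coeff_ge0// mulr_ge0.
- move=> k; rewrite /expcoef !normrM normrX normfV normr_nat /exp_coeff/= exprMn.
  rewrite mulrAC !mulrA ler_wpM2r ?invr_ge0//.
  by rewrite ler_wpM2r// exprn_ge0.
- exact/is_cvg_seriesZ/is_cvg_series_exp_coeff.
Qed.

Lemma pseries_diffs_expcoef d :
  pseries_diffs (expcoef d) = expcoef (fun k => d k.+1).
Proof.
apply/funext => k; rewrite /pseries_diffs /expcoef factS natrM.
by rewrite invfM mulrCA mulVKf// pnatr_eq0.
Qed.

Lemma is_derive_expcoef d C b t : 0 <= b -> (forall k, `|d k| <= C * b ^+ k) ->
  is_derive t 1 (fun s => limn (pseries (expcoef d) s))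
    (limn (pseries (expcoef (fun k => d k.+1)) t)).
Proof.
move=> b0 dC; rewrite -pseries_diffs_expcoef.
have dC1 k : `|d k.+1| <= C * b * b ^+ k by rewrite -mulrA -exprS.
have dC2 k : `|d k.+2| <= C * b * b * b ^+ k by rewrite -!mulrA -!exprS.
apply: (@pseries_snd_diffs _ _ (`|t| + 1)); rewrite ?pseries_diffs_expcoef.
- exact: is_cvg_expcoef dC.
- exact: is_cvg_expcoef dC1.
- exact: is_cvg_expcoef dC2.
- by rewrite [ltRHS]ger0_norm ?ltrDl// addr_ge0.
Qed.

(** Each multiplication by [A] sums three products, hence the 3. The factor 1 matches the bound
    [C * b ^+ k] expected by the power series lemmas. *)
Lemma mx_exp_entry_le A k i j : `|(A ^+ k) i j| <= 1 * (3 * `|A|) ^+ k.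
Proof.
rewrite mul1r; elim: k i j => [|k IH] i j.
  by rewrite !expr0 mxE; case: eqP => _; rewrite ?normr1 ?normr0.
rewrite !exprS -mulmxE mulmx3E.
have B l : `|A i l * (A ^+ k) l j| <= `|A| * (3 * `|A|) ^+ k.
  by rewrite normrM ler_pM// mx_entry_le_norm.
rewrite (le_trans (ler_normD _ _))//.
rewrite (le_trans (lerD (ler_normD _ _) (lexx _)))//.
have := B 0; have := B 1; have := B 2; lra.
Qed.

Definition expm_entry A i j t : R :=
  limn (pseries (expcoef (fun k => (A ^+ k) i j)) t).

Lemma expm_entryE A t i j : expm (t *: A) i j = expm_entry A i j t.
Proof.
rewrite /expm_entry; apply/esym.
have b0 : 0 <= 3 * `|A| by rewrite mulr_ge0.
pose E : 'M[R]_3 := \matrix_(i, j) expm_entry A i j t.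
suff : series (fun k => (k`!%:R)^-1 *: (t *: A) ^+ k) n @[n --> \oo] --> E.
  by move/cvg_lim; rewrite /expm => -> //; rewrite mxE.
apply: cvg_mxP => k l; rewrite mxE /expm_entry.
rewrite [X in X @ _ --> _](_ : _ = pseries (expcoef (fun k0 => (A ^+ k0) k l)) t).
  exact: is_cvg_expcoef (fun k0 => mx_exp_entry_le A k0 k l).
apply/funext => n; rewrite /pseries /series/= summxE; apply: eq_bigr => q _.
by rewrite exprZn !mxE /expcoef; ring.
Qed.

Lemma cvg_lin3 (f g h : nat -> R) a b c x y z :
  f @ \oo --> a -> g @ \oo --> b -> h @ \oo --> c ->
  (fun n => x * f n + y * g n + z * h n) @ \oo --> x * a + y * b + z * c.
Proof.
move=> fa gb hc; apply: cvgD; last exact: cvgMl_tmp.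
by apply: cvgD; exact: cvgMl_tmp.
Qed.

(** Differentiating an exponential series shifts [d k] to [d k.+1], here from entries of [A ^+ k] to
    entries of [A *m A ^+ k]. *)
Lemma is_derive_expm A t :
  is_derive t 1 (fun s => expm (s *: A)) (A *m expm (t *: A)).
Proof.
apply/is_derive_mxP => i j.
have b0 : 0 <= 3 * `|A| by rewrite mulr_ge0.
have -> : (fun s => expm (s *: A) i j) = expm_entry A i j.
  by apply/funext => s; rewrite expm_entryE.
apply: (is_derive_congr (is_derive_expcoef t b0 (fun k => mx_exp_entry_le A k i j))).
rewrite mulmx3E !expm_entryE.
apply/cvg_lim => //.
have C l : pseries (expcoef (fun k => (A ^+ k) l j)) t n @[n --> \oo] -->
    expm_entry A l j t.
  exact: is_cvg_expcoef (fun k => mx_exp_entry_le A k l j).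
rewrite [X in X @ _ --> _](_ : _ = fun n =>
  A i 0 * pseries (expcoef (fun k => (A ^+ k) 0 j)) t n +
  A i 1 * pseries (expcoef (fun k => (A ^+ k) 1 j)) t n +
  A i 2 * pseries (expcoef (fun k => (A ^+ k) 2 j)) t n); first exact: cvg_lin3.
apply/funext => n.
rewrite /= /pseries /series/= !mulr_sumr -!big_split/=.
apply: eq_bigr => k _; rewrite /expcoef exprS -mulmxE mulmx3E; ring.
Qed.

Lemma expm0 : expm (0 : 'M[R]_3) = 1%:M.
Proof.
rewrite /expm; apply/cvg_lim => //.
apply: cvg_near_cst; exists 1%N => // -[//|n] _.
rewrite /series/= big_nat_recl//= expr0 fact0 invr1 scale1r big1 ?addr0//.
by move=> i _; rewrite exprS mul0r scaler0.
Qed.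

Lemma expm_commute A t : A *m expm (t *: A) = expm (t *: A) *m A.
Proof.
apply/matrixP => i j; rewrite !mulmx3E !expm_entryE.
have C l l' : pseries (expcoef (fun k => (A ^+ k) l l')) t n @[n --> \oo] -->
    expm_entry A l l' t.
  apply: (is_cvg_expcoef (b := 3 * `|A|)) (fun k => mx_exp_entry_le A k l l').
  by rewrite mulr_ge0.
have := cvg_lin3 (x := A i 0) (y := A i 1) (z := A i 2) (C 0 j) (C 1 j) (C 2 j).
move/cvg_lim => <- //.
have := cvg_lin3 (x := A 0 j) (y := A 1 j) (z := A 2 j) (C i 0) (C i 1) (C i 2).
rewrite ![_ * expm_entry _ _ _ _]mulrC => /cvg_lim <- //; congr (limn _).
apply/funext => n.
rewrite /= /pseries /series/= !mulr_sumr -!big_split/=.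
apply: eq_bigr => k _; rewrite /expcoef.
have : (A *m A ^+ k) i j = (A ^+ k *m A) i j by rewrite !mulmxE -exprS -exprSr.
rewrite !mulmx3E => E.
transitivity ((A i 0 * (A ^+ k) 0 j + A i 1 * (A ^+ k) 1 j + A i 2 * (A ^+ k) 2 j)
  * (t ^+ k / k`!%:R)); first by ring.
by rewrite E; ring.
Qed.

(* exp(-tA) Y(t) is constant. *)
Lemma expm_unique A (Y : R -> 'M[R]_3) : Y 0 = 1%:M ->
  (forall t, is_derive t 1 Y (A *m Y t)) -> forall t, Y t = expm (t *: A).
Proof.
move=> Y0 dY.
have main (Z : R -> 'M[R]_3) : Z 0 = 1%:M ->
    (forall t, is_derive t 1 Z (A *m Z t)) ->
    forall t, expm (- t *: A) *m Z t = 1%:M.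
  move=> Z0 dZ t.
  have dW (s : R) : is_derive s 1 (fun s => expm (- s *: A) *m Z s) 0.
    have dE : is_derive s 1 (fun s => expm (- s *: A)) (- (A *m expm (- s *: A))).
      apply/is_derive_mxP => i j.
      have /is_derive_mxP/(_ i j) H := is_derive_expm A (- s).
      have := @is_derive1_comp _ (fun s => expm (s *: A) i j) -%R s _ _ H (is_deriveNid _ _).
      by move=> /is_derive_congr; apply; rewrite mulrN1 !mxE.
    apply: (is_derive_congr (is_derive_mulmx dE (dZ s))).
    by rewrite expm_commute mulmxA mulNmx addNr.
  apply/matrixP => i j.
  have H (s : R) : is_derive s 1 (fun s => (expm (- s *: A) *m Z s) i j) 0.
    by have /is_derive_mxP/(_ i j) := dW s; rewrite mxE.
  rewrite (@is_derive_0_is_cst _ (fun s => (expm (- s *: A) *m Z s) i j) t 0 H).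
  by rewrite oppr0 scale0r expm0 Z0 mulmx1.
move=> t.
have E1 := main _ Y0 dY t.
have E2 : expm (- t *: A) *m expm (t *: A) = 1%:M.
  apply: (main (fun s => expm (s *: A))); first by rewrite scale0r expm0.
  exact: is_derive_expm.
by rewrite -[LHS]mul1mx -(mulmx1C E2) -mulmxA E1 mulmx1.
Qed.

End MatrixExponential.

(** * Exponential and logarithm of rotations; geodesics *)

Section Exponential.
Context {R : realType}.
Implicit Types (x y n : 'cV[R]_3) (A P Q X : 'M[R]_3) (t : R).

Lemma is_derive_axrot (a b c : R -> R) (t da db dc : R) n :
  is_derive t 1 a da -> is_derive t 1 b db -> is_derive t 1 c dc ->
  is_derive t 1 (fun s => axrot (a s) (b s) (c s) n) (axrot da db dc n).
Proof.
move=> Da Db Dc; apply/is_derive_mxP => i j.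
rewrite (_ : (fun s => _) = fun s => a s * (n *m n^T) i j
  + b s * (1%:M - n *m n^T) i j + c s * (hat n) i j); last first.
  by apply/funext => s; rewrite /axrot !(mxaddE, mxscaleE).
by apply: is_derive_eq; rewrite /axrot !(mxaddE, mxscaleE) /GRing.scale/=; ring.
Qed.

(** In R x C the exponential of [(a, b + i c)] is computed componentwise; the resulting curve solves
    the linear equation that characterizes [expm]. *)
Lemma expm_axrot (a b c : R) n : dot n n = 1 ->
  expm (axrot a b c n) =
  axrot (expR a) (expR b * cos c) (expR b * sin c) n.
Proof.
move=> n1.
pose Y s := axrot (expR (a * s)) (expR (b * s) * cos (c * s))
  (expR (b * s) * sin (c * s)) n.
suff : Y 1 = expm (1 *: axrot a b c n) by rewrite scale1r /Y !mulr1.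
apply: expm_unique; first by rewrite /Y !mulr0 expR0 cos0 sin0 mulr1 mulr0 axrot1.
move=> s; rewrite /Y axrotM//.
have dl (k : R) : is_derive s 1 (fun s => k * s) k.
  by apply: is_derive_eq; rewrite /GRing.scale/=; ring.
have dexp (k : R) : is_derive s 1 (fun s => expR (k * s)) (k * expR (k * s)).
  have := @is_derive1_comp _ expR ( *%R k) s _ _ _ (dl k).
  by move=> /(_ _ (is_derive_expR _)) /is_derive_congr; apply; rewrite mulrC.
have dcos : is_derive s 1 (fun s => cos (c * s)) (- c * sin (c * s)).
  have := @is_derive1_comp _ cos ( *%R c) s _ _ _ (dl c).
  by move=> /(_ _ (is_derive_cos _)) /is_derive_congr; apply; ring.
have dsin : is_derive s 1 (fun s => sin (c * s)) (c * cos (c * s)).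
  have := @is_derive1_comp _ sin ( *%R c) s _ _ _ (dl c).
  by move=> /(_ _ (is_derive_sin _)) /is_derive_congr; apply; ring.
apply: (@is_derive_axrot (fun s => expR (a * s))
  (fun s => expR (b * s) * cos (c * s)) (fun s => expR (b * s) * sin (c * s))).
- have := dexp b => dexpb; apply: is_derive_eq; rewrite /GRing.scale/=; ring.
- have := dexp b => dexpb; apply: is_derive_eq; rewrite /GRing.scale/=; ring.
Qed.

Lemma hat_axrot t n : hat (t *: n) = axrot 0 0 t n.
Proof. by rewrite hatZ /axrot !scale0r !add0r. Qed.

Lemma expm_hat t n : dot n n = 1 -> expm (hat (t *: n)) = rot t n.
Proof. by move=> n1; rewrite hat_axrot expm_axrot// expR0 !mul1r. Qed.

Lemma geodesic_rot P t r n : dot n n = 1 ->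
  geodesic P (r *: n) t = P *m rot (t * r) n.
Proof. by move=> n1; rewrite /geodesic -hatZ scalerA expm_hat. Qed.

Lemma SO3_geodesic P x t : SO3 P -> SO3 (geodesic P x t).
Proof.
move=> SP; have [n [n1 ->]] := cV3_polar x.
by rewrite geodesic_rot//; apply: SO3M => //; exact: SO3_rot.
Qed.

Lemma geodesic0 P x : geodesic P x 0 = P.
Proof. by rewrite /geodesic scale0r expm0 mulmx1. Qed.

Lemma is_derive_geodesic P x t :
  is_derive t 1 (geodesic P x) (geodesic P x t *m hat x).
Proof.
rewrite /geodesic -mulmxA -expm_commute.
exact/is_derive_mulmxl/is_derive_expm.
Qed.

Lemma axrot_inj (a b c a' b' c' : R) n : dot n n = 1 ->
  axrot a b c n = axrot a' b' c' n -> [/\ a = a', b = b' & c = c'].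
Proof.
move=> n1 E.
have Ea : a = a'.
  have := congr1 (fun X => dot n (X *m n)) E.
  by rewrite /= !axrot_axis// !dotZr n1 !mulr1.
have Eb : b = b'.
  have := congr1 mxtrace E; rewrite !tr_axrot// Ea => H; lra.
have Ec : c = c'.
  have := congr1 (fun X => dot (axial X) n) E.
  by rewrite /= !axial_axrot !dotZl n1 !mulr1.
by split.
Qed.

Lemma orthogonal_exists n : dot n n = 1 -> exists2 x, x != 0 & dot n x = 0.
Proof.
move=> n1; have dc y : dot n (cross n y) = 0 by rewrite !coordE; ring.
have [E0|] := eqVneq (cross n (delta_mx 0 0)) 0; last by exists (cross n (delta_mx 0 0)).
have [E1|] := eqVneq (cross n (delta_mx 1 0)) 0; last by exists (cross n (delta_mx 1 0)).
have n2 : n 2 0 = 0.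
  by have /matrixP/(_ 1 0) := E0; rewrite crossE !mxE /= mulr1 mulr0 subr0.
have n1' : n 1 0 = 0.
  have /matrixP/(_ 2 0) := E0; rewrite crossE !mxE /= mulr1 mulr0 sub0r.
  by move/eqP; rewrite oppr_eq0 => /eqP.
have n0 : n 0 0 = 0.
  by have /matrixP/(_ 2 0) := E1; rewrite crossE !mxE /= mulr1 mulr0 subr0.
by move: n1; rewrite dotE n0 n1' n2 !mulr0 !addr0 => /eqP; rewrite eq_sym oner_eq0.
Qed.

Definition principal X := forall z : R[i],
  eigenvalue (map_mx (real_complex R) X) z -> `|complex.Im z| < pi.

(** For [w] orthogonal to [n], the complex row [w + i (n x w)] is an eigenvector with eigenvalue
    [b + i c]. *)
Lemma principal_axrot (a b c : R) n : dot n n = 1 ->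
  principal (axrot a b c n) -> `|c| < pi.
Proof.
move=> n1 /(_ (Complex b c)); apply; apply/eigenvalueP.
have [w w0 nw] := orthogonal_exists n1.
have [X XE] : exists X, X = axrot a b c n by eexists.
rewrite -XE; have wX : w^T *m X = b *: w^T - c *: (cross n w)^T.
  rewrite XE /axrot mulmxDr -scalemxAr mul_hat_tr scalerN mulmxDr.
  rewrite -!scalemxAr mulmxBr mulmx1 !mulmxA dot_mx dotC nw.
  by rewrite mul_scalar_mx scale0r scaler0 add0r subr0.
have uX : (cross n w)^T *m X = b *: (cross n w)^T + c *: w^T.
  rewrite XE /axrot mulmxDr -scalemxAr mul_hat_tr scalerN mulmxDr.
  have -> : cross n (cross n w) = - w.
    rewrite -!hat_mul mulmxA hat_sqr// mulmxBl mul1mx -mulmxA dot_mx nw.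
    by rewrite mul_mx_scalar scale0r sub0r.
  rewrite -!scalemxAr mulmxBr mulmx1 !mulmxA dot_mx.
  have -> : dot (cross n w) n = 0 by rewrite !coordE; ring.
  by rewrite mul_scalar_mx scale0r scaler0 add0r subr0 linearN/= scalerN opprK.
move: (cross n w) wX uX => u wX uX.
exists (\row_j Complex (w j 0) (u j 0)).
  apply/rowP => j; rewrite !mxE sum3E !mxE.
  have /matrixP/(_ 0 j) := wX; have /matrixP/(_ 0 j) := uX.
  rewrite !mulmx3E !(mxaddE, mxoppE, mxscaleE, mxtrE) => uXj wXj.
  apply/eqP; rewrite eq_complex /=; apply/andP; split; apply/eqP.
    by rewrite -wXj; ring.
  by rewrite -uXj; ring.
apply: contra_neq w0 => v0; apply/colP => i; rewrite mxE.
by have /rowP/(_ i) := v0; rewrite !mxE => -[].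
Qed.

Lemma hat_cube x : hat x *m hat x *m hat x = - dot x x *: hat x.
Proof. by mx3_ring. Qed.

(** The cube of [hat (t *: n)] is [- t^2] times itself, so its eigenvalues lie among 0, [i t] and
    [- i t]. *)
Lemma principal_hat t n : dot n n = 1 -> 0 <= t < pi -> principal (hat (t *: n)).
Proof.
move=> n1 /andP[t0 tpi] z /eigenvalueP[v vz v0].
set X := hat (t *: n) in vz.
set f := real_complex R.
have X3 : X *m X *m X = - (t ^+ 2) *: X.
  by rewrite /X hat_cube dotZl dotZr n1 mulr1 -expr2.
have : v *m map_mx f (X *m X *m X) = v *m map_mx f (- (t ^+ 2) *: X) by rewrite X3.
rewrite !map_mxM map_mxZ -scalemxAr !mulmxA vz -!scalemxAl vz -scalemxAl vz !scalerA.
move/eqP; rewrite -subr_eq0 -scalerBl scaler_eq0 (negPf v0) orbF -mulrBl mulf_eq0.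
rewrite subr_eq0 => /orP[|/eqP ->]; last by rewrite /= normr0 pi_gt0.
case: z {vz} => x y; rewrite /f eq_complex /= => /andP[/eqP E1 /eqP E2].
suff : `|y| = t by move=> ->.
have xy0 : x * y = 0 by lra.
have x0 : x = 0.
  move/eqP: xy0; rewrite mulf_eq0 => /orP[/eqP//|/eqP y0].
  move: E1; rewrite y0; nra.
by apply/eqP; rewrite -(@eqrXn2 _ 2)// real_normK ?num_real//; apply/eqP; nra.
Qed.

(** A logarithm [X] commutes with the rotation and with its transpose, hence with [hat n], a
    multiple of their difference as [sin t] is nonzero. So [X] is an [axrot]; comparing exponentials
    leaves only [c] modulo [2 pi], and principality fixes it. *)
Lemma logm_rot t n : dot n n = 1 -> 0 < t < pi -> logm (rot t n) = hat (t *: n).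
Proof.
move=> n1 /andP[t0 tpi]; have st : 0 < sin t by rewrite sin_gt0_pi// t0.
rewrite /logm; case: xgetP => [X _ [XA pX]|/(_ (hat (t *: n)))]; last first.
  move=> []; split; first exact: expm_hat.
  by apply: principal_hat => //; rewrite tpi ltW.
have XA' : X *m rot t n = rot t n *m X.
  by have := expm_commute X 1; rewrite !scale1r XA.
have SA := SO3_rot t n1.
have XAT : X *m (rot t n)^T = (rot t n)^T *m X.
  have := congr1 (fun Y => (rot t n)^T *m Y *m (rot t n)^T) XA'.
  by rewrite /= !mulmxA (SO3_tr_mul SA) mul1mx -[in LHS]mulmxA -!mulmxA (SO3_mul_tr SA) mulmx1.
have Xn : X *m hat n = hat n *m X.
  have Kn : hat n = (2 * sin t)^-1 *: (rot t n - (rot t n)^T).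
    rewrite axrot_tr /rot /axrot opprD addrACA subrr add0r scaleNr opprK -scalerDl.
    rewrite scalerA (_ : sin t + sin t = 2 * sin t); last by ring.
    rewrite mulVf ?scale1r//.
    by rewrite mulf_neq0// gt_eqF.
  by rewrite Kn -scalemxAr -scalemxAl mulmxBr mulmxBl XA' XAT.
have [a [b [c E]]] := commute_hat n1 Xn.
rewrite E in XA pX *; rewrite expm_axrot// in XA.
have [ea eb ec] := axrot_inj n1 XA.
have cpi := principal_axrot n1 pX.
have a0 : a = 0 by apply: expR_inj; rewrite expR0.
have b0 : b = 0.
  apply: expR_inj; rewrite expR0.
  have b2 : expR b ^+ 2 = 1.
    by rewrite -[RHS](cos2Dsin2 t) -eb -ec -[LHS]mulr1 -(cos2Dsin2 c); ring.
  by have := expR_gt0 b; nra.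
rewrite b0 expR0 !mul1r in eb ec.
have c0 : 0 < c.
  rewrite ltNge; apply/negP => c0.
  have : 0 <= sin (- c).
    by apply: sin_ge0_pi; rewrite oppr_ge0 c0/=; move: cpi; rewrite ltr_norml; lra.
  by rewrite sinN ec; lra.
rewrite hat_axrot a0 b0; congr axrot; apply: cos_inj => //.
  by rewrite in_itv/= ltW//=; move: cpi; rewrite ltr_norml => /andP[_ /ltW].
by rewrite in_itv/= !ltW.
Qed.

End Exponential.

(** * The infimum of curve lengths is the rotation angle *)

Section Distance.
Context {R : realType}.
Implicit Types (x y n : 'cV[R]_3) (P Q X : 'M[R]_3) (t : R).
Local Notation mu := (@lebesgue_measure R).

(** [G] plus the running integral of [h] has nonnegative derivative inside the interval and is
    continuous up to its ends. *)
Lemma decrease_le_Rintegral (G dG h : R -> R) : continuous h ->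
  (forall t, 0 <= t <= 1 -> is_derive t 1 G (dG t)) ->
  (forall t, 0 < t < 1 -> - dG t <= h t) ->
  G 0 - G 1 <= \int[mu]_(t in `[0, 1]) h t.
Proof.
move=> ch dGP dGh.
have ih : mu.-integrable `[0, 1] (EFin \o h).
  apply: continuous_compact_integrable; first exact: segment_compact.
  by apply: continuous_subspaceT => t; exact: ch.
pose H (x : R) := \int[mu]_(t in `[0, x]) h t.
have H0 : H 0 = 0 by rewrite /H set_itv1 Rintegral_set1.
have dH t : 0 < t < 1 -> is_derive t 1 H (h t).
  move=> /andP[t0 t1]; have [dF E] := continuous_FTC1_closed t1 ih t0 (ch t).
  by apply: DeriveDef; [exact: dF|rewrite -derive1E; exact: E].
suff : G 0 + H 0 <= G 1 + H 1 by rewrite H0 /H; lra.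
have dW t : 0 < t < 1 -> is_derive t 1 (fun s => G s + H s) (dG t + h t).
  move=> t01; have := dH t t01; have := dGP t; case/andP: t01 => ? ? dGt dHt.
  have {}dGt := dGt (introT andP (conj (ltW _) (ltW _))).
  by apply: is_deriveD; apply: dGt.
apply: (@ger0_derive1_ndecr R (fun s => G s + H s) 0 1) => //.
- move=> t /[!in_itv]/= t01; exact: (@ex_derive _ _ _ _ _ _ _ (dW t t01)).
- move=> t /[!in_itv]/= t01; rewrite derive1E (@derive_val _ _ _ _ _ _ _ (dW t t01)).
  by have := dGh t t01; lra.
- have cG : {within `[0, 1], continuous G}.
    apply: derivable_within_continuous => t /[!in_itv]/= t01.
    exact: (@ex_derive _ _ _ _ _ _ _ (dGP t t01)).
  have cH := parameterized_integral_continuous (@ler01 R) ih.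
  by move=> t; apply: cvgD; [exact: cG|exact: cH].
Qed.

(** Both sides are the squared sine of the rotation angle. *)
Lemma axial_rotation P : SO3 P ->
  dot (axial P) (axial P) = 1 - ((\tr P - 1) / 2) ^+ 2.
Proof.
move=> SP; have [t [n [n1 _ ->]]] := rot_exists SP.
rewrite axial_axrot dotZl dotZr n1 mulr1 tr_axrot// -expr2 sin2cos2.
by field.
Qed.

Lemma is_derive1_trmx m p (c : R -> 'M[R]_(m, p)) t (D : 'M[R]_(m, p)) :
  is_derive t 1 c D -> is_derive t 1 (fun s => (c s)^T) D^T.
Proof.
move=> /is_derive_mxP cD; apply/is_derive_mxP => i j.
rewrite mxE (_ : (fun s => _) = fun s => c s j i)//.
by apply/funext => s; rewrite mxE.
Qed.

Lemma is_derive1_near_cst (V : normedModType R) (f : R -> V) t a :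
  (\forall s \near t, f s = a) -> is_derive t 1 f 0.
Proof.
move=> fa; apply: (@near_eq_is_derive _ _ _ (cst a)) => //.
by near=> z; rewrite (near fa z).
Unshelve. all: by end_near. Qed.

(** Differentiating [c^T c = 1] shows that [c^T c'] is skew. The constraint must hold on both sides
    of [t], so on a curve restricted to [[0, 1]] this is used at interior times only. *)
Lemma SO3_velocity (c : R -> 'M[R]_3) t D : is_derive t 1 c D ->
  (\forall s \near t, SO3 (c s)) -> (c t)^T *m D = hat (vee ((c t)^T *m D)).
Proof.
move=> cD cS; have d1 := is_derive_mulmx (is_derive1_trmx cD) cD.
have d2 : is_derive t 1 (fun s => (c s)^T *m c s) 0.
  apply: (@is_derive1_near_cst _ _ _ 1%:M).
  by apply: filterS cS => s; exact: SO3_tr_mul.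
have : D^T *m c t + (c t)^T *m D = 0.
  by rewrite -(@derive_val _ _ _ _ _ _ _ d1) (@derive_val _ _ _ _ _ _ _ d2).
have -> : D^T *m c t = ((c t)^T *m D)^T by rewrite trmx_mul trmxK.
move: ((c t)^T *m D) => X /matrixP XX.
have {}XX i j : X j i + X i j = 0 by have := XX i j; rewrite !dentE.
have := XX 0 0; have := XX 1 1; have := XX 2 2.
have := XX 0 1; have := XX 0 2; have := XX 1 2 => *.
by apply: mx3P; split; rewrite hatE ?veeE; lra.
Qed.

Lemma continuous_speed (c : R -> 'M[R]_3) : C1_curve c ->
  continuous (fun t => norm2 (vee ((c t)^T *m derive1 c t))).
Proof.
move=> [dc cdc] t.
have cc : {for t, continuous c}.
  by apply/differentiable_continuous/derivable1_diffP.
have E i j : {for t, continuous (fun s => ((c s)^T *m derive1 c s) i j)}.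
  rewrite (_ : (fun s => _) = fun s => c s 0 i * derive1 c s 0 j
    + c s 1 i * derive1 c s 1 j + c s 2 i * derive1 c s 2 j); last first.
    by apply/funext => s; rewrite mulmx3E !mxtrE.
  have c1 k : {for t, continuous (fun s => c s k i)} by exact: cvg_mx_entry cc.
  have c2 k : {for t, continuous (fun s => derive1 c s k j)}.
    exact: cvg_mx_entry (cdc t).
  by apply: cvgD; [apply: cvgD|]; apply: cvgM; (exact: c1 || exact: c2).
rewrite (_ : (fun t0 => _) = Num.sqrt \o
  (fun s => dot (vee ((c s)^T *m derive1 c s)) (vee ((c s)^T *m derive1 c s))))//.
apply: continuous_comp; last exact: sqrt_continuous.
rewrite (_ : (fun s => _) = fun s =>
   ((c s)^T *m derive1 c s) 2 1 * ((c s)^T *m derive1 c s) 2 1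
 + ((c s)^T *m derive1 c s) 0 2 * ((c s)^T *m derive1 c s) 0 2
 + ((c s)^T *m derive1 c s) 1 0 * ((c s)^T *m derive1 c s) 1 0); last first.
  by apply/funext => s; rewrite dotE !veeE.
by apply: cvgD; [apply: cvgD|]; apply: cvgM; exact: E.
Qed.

Lemma is_derive1_cosang Q (c : R -> 'M[R]_3) t x :
  is_derive t 1 c (c t *m hat x) ->
  is_derive t 1 (fun s => cosang Q (c s)) (- dot (axial (Q^T *m c t)) x).
Proof.
move=> cD; have /is_derive_mxP d := is_derive_mulmxl Q^T cD.
rewrite (_ : (fun s => _) = fun s => ((Q^T *m c s) 0 0 + (Q^T *m c s) 1 1
   + (Q^T *m c s) 2 2 - 1) / 2); last first.
  by apply/funext => s; rewrite /cosang tr3E.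
have d0 := d 0 0; have d1 := d 1 1; have d2 := d 2 2.
apply: is_derive_eq; rewrite /GRing.scale/=.
have := tr_mul_hat (Q^T *m c t) x; rewrite tr3E !mulmxA => H.
have -> : - dot (axial (Q^T *m c t)) x = 2^-1 * (- 2 * dot (axial (Q^T *m c t)) x).
  by field.
by rewrite -H; ring.
Qed.

(** The cosine [g] of the angle to [Q] has derivative minus the inner product of an axial vector of
    norm [sqrt (1 - g^2)] with the velocity. By Cauchy-Schwarz the angle changes no faster than the
    curve moves. *)
Lemma curve_length_ge Q (c : R -> 'M[R]_3) : SO3 Q -> C1_curve c ->
  (forall t, 0 <= t <= 1 -> SO3 (c t)) ->
  acos (cosang Q (c 0)) - acos (cosang Q (c 1)) <= curve_length c.
Proof.
move=> SQ cC cS; have [dc cdc] := cC.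
have g1 t : 0 <= t <= 1 -> -1 <= cosang Q (c t) <= 1.
  by move=> t01; apply: cosang_itv => //; exact: cS.
apply: acosB_le_scaled; rewrite ?g1 ?lexx ?ler01//.
move=> /= l l01; rewrite /curve_length.
have lg t : 0 <= t <= 1 -> -1 < l * cosang Q (c t) < 1.
  by move=> /g1; nra.
have cosD t : derivable (fun s => cosang Q (c s)) t 1.
  have : is_derive t 1 c ('D_1 c t) by apply: DeriveDef.
  move=> /(is_derive_mulmxl Q^T)/is_derive_mxP d.
  have -> : (fun s => cosang Q (c s)) = fun s => ((Q^T *m c s) 0 0 +
      (Q^T *m c s) 1 1 + (Q^T *m c s) 2 2 - 1) / 2.
    by apply/funext => s; rewrite /cosang tr3E.
  have d0 := d 0 0; have d1 := d 1 1; have d2 := d 2 2.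
  by apply: ex_derive.
pose dg t := 'D_1 (fun s => cosang Q (c s)) t.
apply: (@decrease_le_Rintegral (fun t => acos (l * cosang Q (c t)))
  (fun t => - (sin (acos (l * cosang Q (c t))))^-1 * (l * dg t))).
- exact: continuous_speed.
- move=> t t01.
  have dgt : is_derive t 1 (fun s => cosang Q (c s)) (dg t) by apply: DeriveDef.
  have dlg : is_derive t 1 (fun s => l * cosang Q (c s)) (l * dg t).
    by apply: is_derive_eq.
  apply: (@is_derive1_comp _ acos (fun s => l * cosang Q (c s))).
  exact/is_derive1_acos_sin/lg.
- move=> t /andP[t0 t1]; have t01 : 0 <= t <= 1 by rewrite !ltW.
  have ct : is_derive t 1 c (derive1 c t) by rewrite derive1E; apply: DeriveDef.
  have nS : \forall s \near t, SO3 (c s).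
    have : \forall s \near t, s \in `]0, 1[ by apply: near_in_itvoo; rewrite in_itv/= t0.
    apply: filterS => s /[!in_itv]/= /andP[s0 s1].
    by apply: cS; rewrite !ltW.
  have E := SO3_velocity ct nS; set x := vee _ in E *.
  have St := cS t t01.
  have ct' : is_derive t 1 c (c t *m hat x).
    by rewrite -E mulmxA (SO3_mul_tr St) mul1mx.
  have -> : dg t = - dot (axial (Q^T *m c t)) x.
    by have := is_derive1_cosang Q ct' => /(@derive_val _ _ _ _ _ _ _).
  have A2 := axial_rotation (SO3M (SO3_tr SQ) St).
  have := cauchy_schwarz (axial (Q^T *m c t)) x.
  rewrite A2 -/(cosang Q (c t)) -norm2_sqr.
  have := lg t t01; set g := cosang Q (c t) => lg1.
  have s0 := sin_acos_gt0 lg1; have s2 := sin_acos2 (itvoo_cc lg1).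
  set s := sin (acos (l * g)) in s0 s2 *.
  set d := dot _ x => CS.
  have nx := norm2_ge0 x.
  rewrite mulNr opprK mulrN mulrC -mulNr ler_pdivrMr// mulrC.
  rewrite (_ : d * - l = l * - d) 1?[norm2 x * s]mulrC; last by ring.
  have : (l * - d) ^+ 2 <= (s * norm2 x) ^+ 2.
    rewrite !exprMn sqrrN s2 (le_trans (ler_wpM2l (sqr_ge0 l) CS))//.
    rewrite mulrA ler_wpM2r ?sqr_ge0//.
    have l2 : l ^+ 2 <= 1 by nra.
    (* The scaling preserves the estimate: [l^2 - (l g)^2 <= 1 - (l g)^2], the latter being the
       squared sine of the scaled angle. *)
    have -> : l ^+ 2 * (1 - g ^+ 2) = l ^+ 2 - (l * g) ^+ 2 by ring.
    by lra.
  have : 0 <= s * norm2 x by rewrite mulr_ge0// ltW.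
  move: (s * norm2 x) (l * - d) => u v u0 uv.
  by rewrite (le_trans (ler_norm _))// -(@ler_pXn2r _ 2)// ?nnegrE// real_normK// num_real.
Qed.

(** The angle to [Q] vanishes at the endpoint [Q], and its decreases along the successive pieces
    telescope. *)
Lemma joins_length_ge (s : seq (R -> 'M[R]_3)) P Q : SO3 P -> SO3 Q -> joins P s Q ->
  acos (cosang Q P) <= \sum_(c <- s) curve_length c.
Proof.
move=> + SQ; elim: s P => [|c s IH] P SP /=.
  move=> ->; rewrite big_nil /cosang (SO3_tr_mul SQ) mxtrace1.
  by rewrite (_ : (3%:R - 1) / 2 = 1 :> R) ?acos1//; field.
move=> [cC cS cP cs]; rewrite big_cons.
have /IH H1 : SO3 (c 1) by apply: cS; rewrite ler01 lexx.
have := curve_length_ge SQ cC cS; rewrite cP.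
by have := H1 cs; lra.
Qed.

Lemma C1_curve_geodesic P x : C1_curve (geodesic P x).
Proof.
have E : derive1 (geodesic P x) = fun t => geodesic P x t *m hat x.
  apply/funext => t; rewrite derive1E.
  by have := is_derive_geodesic P x t => /(@derive_val _ _ _ _ _ _ _).
split; first by move=> t; have := is_derive_geodesic P x t => /(@ex_derive _ _ _ _ _ _ _).
move=> t; rewrite E.
exact: is_derive1_continuous (is_derive_mulmxr _ (is_derive_geodesic P x t)).
Qed.

Lemma curve_length_geodesic P x : SO3 P -> curve_length (geodesic P x) = norm2 x.
Proof.
move=> SP; rewrite /curve_length.
under eq_Rintegral => t _.
  rewrite derive1E (@derive_val _ _ _ _ _ _ _ (is_derive_geodesic P x t)).
  rewrite mulmxA (SO3_tr_mul (SO3_geodesic x t SP)) mul1mx veeK; over.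
by rewrite Rintegral_cst//= lebesgue_measure_itv/= lte_fin ltr01 sube0/= mulr1.
Qed.

Lemma minimal_geodesic P Q : SO3 P -> SO3 Q ->
  exists x, geodesic P x 1 = Q /\ norm2 x = acos (cosang P Q).
Proof.
move=> SP SQ; have [t [n [n1 t0 E]]] := rot_exists (SO3M (SO3_tr SP) SQ).
exists (t *: n); split.
  by rewrite geodesic_rot// mul1r -E mulmxA (SO3_mul_tr SP) mul1mx.
rewrite (cosang_rot n1 E) acos_cos// norm2Z norm2_unit// mulr1.
by rewrite ger0_norm//; case/andP: t0.
Qed.

Lemma dist_acos P Q : SO3 P -> SO3 Q -> dist P Q = acos (cosang P Q).
Proof.
move=> SP SQ; have [x [xQ nx]] := minimal_geodesic SP SQ.
have Sin : [set \sum_(c <- s) curve_length c | s in [set s | joins P s Q]]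
    (acos (cosang P Q)).
  exists [:: geodesic P x]; last by rewrite big_seq1 curve_length_geodesic.
  rewrite /= geodesic0; split => //; first exact: C1_curve_geodesic.
  by move=> t _; exact: SO3_geodesic.
have lb : lbound [set \sum_(c <- s) curve_length c | s in [set s | joins P s Q]]
    (acos (cosang P Q)).
  by move=> _ [s js <-]; rewrite cosangC; exact: joins_length_ge.
apply/eqP; rewrite eq_le; apply/andP; split.
  by apply: ge_inf => //; exists (acos (cosang P Q)).
by apply: lb_le_inf => //; exists (acos (cosang P Q)).
Qed.

End Distance.

(** * C^2 regularity of sums of squared distances *)

Section Smoothness.
Context {R : realType}.
Implicit Types (P Q A V : 'M[R]_3).

Lemma cosangE Q A : cosang Q A =
  (Q 0 0 * A 0 0 + Q 1 0 * A 1 0 + Q 2 0 * A 2 0 +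
  (Q 0 1 * A 0 1 + Q 1 1 * A 1 1 + Q 2 1 * A 2 1) +
  (Q 0 2 * A 0 2 + Q 1 2 * A 1 2 + Q 2 2 * A 2 2) - 1) / 2.
Proof. by rewrite /cosang ?(coordE, dentE). Qed.

Lemma continuous_cosang Q : continuous (cosang Q).
Proof.
move=> A; have FA : Filter (nbhs A) := nbhs_filter A.
have c i j : {for A, continuous (fun A : 'M[R]_3 => A i j)} by exact: coord_continuous.
rewrite (_ : cosang Q = fun A => (Q 0 0 * A 0 0 + Q 1 0 * A 1 0 + Q 2 0 * A 2 0 +
  (Q 0 1 * A 0 1 + Q 1 1 * A 1 1 + Q 2 1 * A 2 1) +
  (Q 0 2 * A 0 2 + Q 1 2 * A 1 2 + Q 2 2 * A 2 2) - 1) / 2); last first.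
  by apply/funext => B; rewrite cosangE.
apply: cvgM; last exact: cvg_cst.
apply: cvgB; last exact: cvg_cst.
by do ![apply: cvgD]; apply: cvgM; (exact: c || exact: cvg_cst).
Qed.

Lemma cvg_sumr T (F : set_system T) {FF : Filter F} n (f : 'I_n -> T -> R) (a : 'I_n -> R) :
  (forall i, f i x @[x --> F] --> a i) ->
  \sum_(i < n) f i x @[x --> F] --> \sum_(i < n) a i.
Proof.
by move=> fa; apply: cvg_big => // x; exact: add_continuous.
Qed.

Lemma cosang_line Q A V (h : R) :
  cosang Q (h *: V + A) = cosang Q A + h * (\tr (Q^T *m V) / 2).
Proof. by rewrite /cosang mulmxDr -scalemxAr mxtraceD mxtraceZ; field. Qed.

Lemma is_derive_line (f : 'M[R]_3 -> R) A V (d : R) :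
  is_derive (0 : R) 1 (fun h : R => f (h *: V + A)) d -> is_derive A V f d.
Proof.
move=> H; apply: DeriveDef; first by apply/derivable1P; exact: ex_derive.
rewrite -(@derive_val _ _ _ _ _ _ _ H) /derive.
set g1 := fun h => h^-1 *: _; set g2 := fun h => h^-1 *: _.
suff -> : g1 = g2 by [].
by apply/funext => h; rewrite /g1 /g2 /= addr0 scale0r add0r [_%:A]mulr1.
Qed.

Lemma is_derive_cosang_comp (f df : R -> R) Q A V :
  is_derive (cosang Q A) 1 f (df (cosang Q A)) ->
  is_derive A V (fun B => f (cosang Q B)) (df (cosang Q A) * (\tr (Q^T *m V) / 2)).
Proof.
move=> fD; apply: is_derive_line.
rewrite (_ : (fun h => _) =
    f \o (fun h : R => cosang Q A + h * (\tr (Q^T *m V) / 2))); last first.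
  by apply/funext => h; rewrite /= cosang_line.
apply: is_derive1_comp; first by rewrite mul0r addr0.
by apply: is_derive_eq; rewrite /GRing.scale/=; ring.
Qed.

(** Within SO(3), the complement of the cut loci of the [Q i]. No upper bound on the cosine is
    imposed, so the set is open among all matrices and contains the [Q i] whose mutual distances are
    less than [pi]. *)
Definition cosang_dom n (Q : 'I_n -> 'M[R]_3) : set 'M[R]_3 :=
  [set A | forall i, -1 < cosang (Q i) A].

Lemma near_cosang_dom n (Q : 'I_n -> 'M[R]_3) A : cosang_dom Q A ->
  \forall B \near A, cosang_dom Q B.
Proof.
move=> QA; have : \forall B \near A, forall i, -1 < cosang (Q i) B; last by [].
have FA : Filter (nbhs A) := nbhs_filter A.
apply: (@filter_forall _ _ (fun i B => -1 < cosang (Q i) B) (nbhs A) FA) => i.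
exact: (@continuous_cosang (Q i) A _ (lt_nbhsr (QA i))).
Qed.

Lemma open_cosang_dom n (Q : 'I_n -> 'M[R]_3) : open (cosang_dom Q).
Proof. by rewrite openE => A; exact: near_cosang_dom. Qed.

Lemma C1_ambient_eq (f g : 'M[R]_3 -> R) (W : set 'M[R]_3) : open W ->
  (forall A, W A -> f A = g A) -> C1_ambient g W -> C1_ambient f W.
Proof.
move=> oW fg gC A V WA; have [dg cg] := gC A V WA.
have FA : Filter (nbhs A) := nbhs_filter A.
have nW : \forall B \near A, W B by exact: open_nbhs_nbhs.
have nfg : \forall B \near A, g B = f B by apply: filterS nW => B WB; rewrite fg.
split; first exact: near_eq_derivable nfg dg.
have nD : \forall B \near A, 'D_V g B = 'D_V f B.
  apply: filterS (nbhs_interior nfg) => B nB; exact: near_eq_derive.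
rewrite /prop_for /continuous_at -(nbhs_singleton nD).
by apply: cvg_trans cg; exact: near_eq_cvg.
Qed.

(** Used twice for C^2: for the function itself, then for its directional derivatives, which have
    the same shape because [cosang] is affine. *)
Lemma C1_ambient_cosang n (Q : 'I_n -> 'M[R]_3) (f df : 'I_n -> R -> R) :
  (forall i (u : R), -1 < u -> is_derive u 1 (f i) (df i u)) ->
  (forall i (u : R), -1 < u -> {for u, continuous (df i)}) ->
  C1_ambient (fun A => \sum_(i < n) f i (cosang (Q i) A)) (cosang_dom Q) /\
  forall A V, cosang_dom Q A ->
    'D_V (fun A => \sum_(i < n) f i (cosang (Q i) A)) A =
    \sum_(i < n) df i (cosang (Q i) A) * (\tr ((Q i)^T *m V) / 2).
Proof.
move=> fD dfC.
have D A V : cosang_dom Q A ->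
    is_derive A V (fun A => \sum_(i < n) f i (cosang (Q i) A))
      (\sum_(i < n) df i (cosang (Q i) A) * (\tr ((Q i)^T *m V) / 2)).
  move=> QA; rewrite (_ : (fun A => _) = \sum_(i < n) fun A => f i (cosang (Q i) A)).
    by apply: is_derive_sum => i; exact/is_derive_cosang_comp/fD.
  by apply/funext => B; rewrite fct_sumE.
have DV A V : cosang_dom Q A ->
    'D_V (fun A => \sum_(i < n) f i (cosang (Q i) A)) A =
    \sum_(i < n) df i (cosang (Q i) A) * (\tr ((Q i)^T *m V) / 2).
  by move=> QA; rewrite (@derive_val _ _ _ _ _ _ _ (D A V QA)).
split=> // A V QA; split; first exact: (@ex_derive _ _ _ _ _ _ _ (D A V QA)).
have FA : Filter (nbhs A) := nbhs_filter A.
have nD : \forall B \near A,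
    \sum_(i < n) df i (cosang (Q i) B) * (\tr ((Q i)^T *m V) / 2) =
    'D_V (fun A => \sum_(i < n) f i (cosang (Q i) A)) B.
  by apply: filterS (near_cosang_dom QA) => B QB; rewrite DV.
rewrite /prop_for /continuous_at -(nbhs_singleton nD).
apply: (@cvg_trans _
    (\sum_(i < n) df i (cosang (Q i) B) * (\tr ((Q i)^T *m V) / 2) @[B --> A])).
  exact: near_eq_cvg.
apply: (@cvg_sumr _ (nbhs A) FA n
  (fun i B => df i (cosang (Q i) B) * (\tr ((Q i)^T *m V) / 2))
  (fun i => df i (cosang (Q i) A) * (\tr ((Q i)^T *m V) / 2))) => i.
apply: cvgM; last exact: cvg_cst.
by apply: (@continuous_comp _ _ _ (cosang (Q i)) (df i));
  [exact: continuous_cosang|exact: dfC].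
Qed.

Lemma C2_ambient_sq_angle n (Q : 'I_n -> 'M[R]_3) (k : 'I_n -> R) :
  C2_ambient (fun A => \sum_(i < n) k i / 2 * cangle2 (cosang (Q i) A)) (cosang_dom Q).
Proof.
pose f i u := k i / 2 * cangle2 u; pose df i u := k i / 2 * dcangle2 u.
have fD i (u : R) : -1 < u -> is_derive u 1 (f i) (df i u).
  by move=> u1; have := is_derive1_cangle2 u1 => ?; apply: is_derive_eq.
have dfC i (u : R) : -1 < u -> {for u, continuous (df i)}.
  move=> u1; apply: cvgM; first exact: cvg_cst.
  exact: is_derive1_continuous (is_derive1_dcangle2 u1).
have [C1 D1] := C1_ambient_cosang Q fD dfC.
split => // V.
pose g i u := df i u * (\tr ((Q i)^T *m V) / 2).
pose dg i u := k i / 2 * ddcangle2 u * (\tr ((Q i)^T *m V) / 2).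
apply: (@C1_ambient_eq _ (fun A => \sum_(i < n) g i (cosang (Q i) A))).
- exact: open_cosang_dom.
- by move=> A QA; rewrite D1.
apply: (C1_ambient_cosang Q (df := dg) _ _).1 => i u u1.
- have := is_derive1_dcangle2 u1 => ?; apply: is_derive_eq.
  by rewrite /GRing.scale/= /dg; ring.
- apply: cvgM; last exact: cvg_cst.
  by apply: cvgM; [exact: cvg_cst|exact: continuous_ddcangle2].
Qed.

Lemma sq_dist P Q : SO3 P -> SO3 Q -> dist P Q ^+ 2 = cangle2 (cosang Q P).
Proof.
move=> SP SQ; rewrite dist_acos// cosangC cangle2E//.
by case/andP: (cosang_itv SQ SP).
Qed.

Lemma C2_on_sum_sq_dist n (Q : 'I_n -> 'M[R]_3) (k : 'I_n -> R) (U : set 'M[R]_3) :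
  (forall i, SO3 (Q i)) -> U `<=` SO3 -> U `<=` cosang_dom Q ->
  C2_on (fun P => \sum_(i < n) k i / 2 * dist P (Q i) ^+ 2) U.
Proof.
move=> SQ US UQ P UP; exists (cosang_dom Q).
exists (fun A => \sum_(i < n) k i / 2 * cangle2 (cosang (Q i) A)); split.
- exact: open_cosang_dom.
- exact: UQ.
- exact: C2_ambient_sq_angle.
- move=> A /[!inE] -[_ UA]; apply: eq_bigr => i _.
  by rewrite sq_dist//; exact: US.
Qed.

End Smoothness.

(** * Gradient and Hessian of one squared distance *)

Section GradientHessian.
Context {R : realType}.
Implicit Types (P Q A : 'M[R]_3) (x y n : 'cV[R]_3) (k u t : R).

(* The ratio [angle / sin angle] as a function of the cosine of the angle. *)
Definition angle_ratio u := - dcangle2 u / 2.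

Definition gradsq k Q P : 'cV[R]_3 :=
  (k * angle_ratio (cosang Q P)) *: axial (Q^T *m P).

Lemma is_derive1_sq_angle k Q (c : R -> 'M[R]_3) t x :
  is_derive t 1 c (c t *m hat x) -> -1 < cosang Q (c t) ->
  is_derive t 1 (fun s => k / 2 * cangle2 (cosang Q (c s))) (dot (gradsq k Q (c t)) x).
Proof.
move=> cD u1; have d1 := is_derive1_cosang Q cD.
have d2 := @is_derive1_comp _ cangle2 (fun s => cosang Q (c s)) _ _ _
  (is_derive1_cangle2 u1) d1.
have d3 : is_derive t 1 (fun s => cangle2 (cosang Q (c s)))
  (dcangle2 (cosang Q (c t)) * - dot (axial (Q^T *m c t)) x) by exact: d2.
by apply: is_derive_eq; rewrite /gradsq dotZl /angle_ratio /GRing.scale/=; field.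
Qed.

Lemma is_derive_scaleZ (f : R -> R) (v : R -> 'cV[R]_3) t df dv :
  is_derive t 1 f df -> is_derive t 1 v dv ->
  is_derive t 1 (fun s => f s *: v s) (df *: v t + f t *: dv).
Proof.
move=> fD /is_derive_mxP vD; apply/is_derive_mxP => i j.
rewrite (_ : (fun s => _) = fun s => f s * v s i j); last first.
  by apply/funext => s; rewrite mxscaleE.
by have := vD i j => ?; apply: is_derive_eq; rewrite mxaddE !mxscaleE /GRing.scale/=; ring.
Qed.

Lemma is_derive_axial (X : R -> 'M[R]_3) t (D : 'M[R]_3) :
  is_derive t 1 X D -> is_derive t 1 (fun s => axial (X s)) (axial D).
Proof.
move=> /is_derive_mxP XD; apply/is_derive_mxP => i j; rewrite (ord1 j).
have XXD a b c d : is_derive t 1 (fun s => 2^-1 * (X s a b - X s c d))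
    (2^-1 * (D a b - D c d)).
  by have := XD a b; have := XD c d => ? ?; apply: is_derive_eq.
by elim/ord3_ind: i; rewrite axialE; under eq_fun do rewrite axialE; exact: XXD.
Qed.

Lemma is_derive_hat (v : R -> 'cV[R]_3) t (D : 'cV[R]_3) :
  is_derive t 1 v D -> is_derive t 1 (fun s => hat (v s)) (hat D).
Proof.
move=> /is_derive_mxP vD; apply/is_derive_mxP => i j.
have v0 := vD 0 0; have v1 := vD 1 0; have v2 := vD 2 0.
by elim/ord3_ind: i; elim/ord3_ind: j; under eq_fun do rewrite hatE;
  rewrite hatE; apply: is_derive_eq.
Qed.

(** The product rule applied to the body coordinates of the gradient. It is not yet the Hessian: the
    derivative of the moving frame contributes half a cross product. *)
Definition dgradsq k Q P x : 'cV[R]_3 :=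
  (k * (ddcangle2 (cosang Q P) / 2 * dot (axial (Q^T *m P)) x)) *: axial (Q^T *m P)
  + (k * angle_ratio (cosang Q P)) *: axial (Q^T *m P *m hat x).

Lemma is_derive1_gradsq k Q (c : R -> 'M[R]_3) t x :
  is_derive t 1 c (c t *m hat x) -> -1 < cosang Q (c t) ->
  is_derive t 1 (fun s => gradsq k Q (c s)) (dgradsq k Q (c t) x).
Proof.
move=> cD u1; have d1 := is_derive1_cosang Q cD.
have d2 := @is_derive1_comp _ dcangle2 (fun s => cosang Q (c s)) _ _ _
  (is_derive1_dcangle2 u1) d1.
have d3 : is_derive t 1 (fun s => dcangle2 (cosang Q (c s)))
  (ddcangle2 (cosang Q (c t)) * - dot (axial (Q^T *m c t)) x) by exact: d2.
have d4 : is_derive t 1 (fun s => k * angle_ratio (cosang Q (c s)))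
  (k * (ddcangle2 (cosang Q (c t)) / 2 * dot (axial (Q^T *m c t)) x)).
  by rewrite /angle_ratio; apply: is_derive_eq; rewrite /GRing.scale/=; field.
have d5 := is_derive_axial (is_derive_mulmxl Q^T cD).
by apply: (is_derive_congr (is_derive_scaleZ d4 d5)); rewrite mulmxA.
Qed.

(** With [lam = (t/2) cot (t/2)] and [e] the unit axis this is [k (lam 1 + (1 - lam) e e^T)].
    Written with the axial vector, of squared norm [1 - u^2], it avoids dividing by the sine and
    remains valid at angle 0. *)
Definition hesssq k Q P : 'M[R]_3 :=
  (k * (angle_ratio (cosang Q P) * (1 + cosang Q P) / 2))%:M +
  (k * (ddcangle2 (cosang Q P) / 2 - angle_ratio (cosang Q P) / (2 * (1 + cosang Q P))))
    *: (axial (Q^T *m P) *m (axial (Q^T *m P))^T).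

Lemma axial_mul_hat t n x : dot n n = 1 ->
  axial (rot t n *m hat x) + 2^-1 *: cross x (sin t *: n) =
  ((1 + cos t) / 2) *: x - ((1 - cos t) / 2 * dot n x) *: n.
Proof.
move=> n1.
(* The factor [dot n n] turns the claim into a polynomial identity valid for every [n]. *)
transitivity (cos t *: x + ((1 - cos t) / 2) *: (dot n n *: x)
  - ((1 - cos t) / 2 * dot n x) *: n).
  by rewrite /rot /axrot; apply: cV3P; rewrite ?(coordE, dentE); field.
by rewrite n1 scale1r -scalerDl; congr (_ *: _ - _); field.
Qed.

(** The half cross product cancels the asymmetric part of [axial (Q^T P hat x)], by [axial_mul_hat];
    what remains acts by scalars along the axis and across it. *)
Lemma dgradsq_hesssq k Q P x : SO3 P -> SO3 Q -> -1 < cosang Q P ->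
  dgradsq k Q P x + 2^-1 *: cross x (gradsq k Q P) = hesssq k Q P *m x.
Proof.
move=> SP SQ; have [t [n [n1 _ E]]] := rot_exists (SO3M (SO3_tr SQ) SP).
rewrite /dgradsq /gradsq /hesssq E axial_axrot (cosang_rot n1 E) => c1.
rewrite mulmxDl mul_scalar_mx -scalemxAl -mulmxA dot_mx mul_mx_scalar.
have := axial_mul_hat t x n1.
move/(congr1 (fun v => (k * angle_ratio (cos t)) *: v)).
have -> : 2^-1 *: cross x ((k * angle_ratio (cos t)) *: (sin t *: n)) =
  (k * angle_ratio (cos t)) *: (2^-1 *: cross x (sin t *: n)) by cV3_ring.
rewrite scalerDr => H.
rewrite -addrA H.
have c2 : 1 + cos t != 0 by rewrite gt_eqF//; lra.
have s2 : sin t ^+ 2 = (1 - cos t) * (1 + cos t) by rewrite sin2cos2; ring.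
rewrite scalerBr !scalerA [LHS]addrCA; congr (_ + _); first by congr (_ *: _); ring.
rewrite -scaleNr -scalerDl; congr (_ *: _); rewrite dotZl.
transitivity (k * (ddcangle2 (cos t) / 2 * sin t ^+ 2 * dot n x)
  - k * angle_ratio (cos t) * ((1 - cos t) / 2 * dot n x)); first by ring.
rewrite s2.
transitivity (k * (ddcangle2 (cos t) / 2 - angle_ratio (cos t) / (2 * (1 + cos t)))
  * sin t ^+ 2 * dot n x); last by ring.
by rewrite s2; field.
Qed.

Lemma hesssq_tr k Q P : (hesssq k Q P)^T = hesssq k Q P.
Proof. by rewrite /hesssq linearD/= tr_scalar_mx linearZ/= trmx_mul trmxK. Qed.

Lemma hesssq_form k Q P x : dot x (hesssq k Q P *m x) =
  k * (angle_ratio (cosang Q P) * (1 + cosang Q P) / 2 * dot x x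
   + (ddcangle2 (cosang Q P) / 2 - angle_ratio (cosang Q P) / (2 * (1 + cosang Q P)))
     * dot (axial (Q^T *m P)) x ^+ 2).
Proof.
rewrite /hesssq mulmxDl mul_scalar_mx -scalemxAl -mulmxA dot_mx mul_mx_scalar.
by rewrite !dotE !(mxaddE, mxscaleE); ring.
Qed.

Lemma angle_ratioE u : -1 < u < 1 -> angle_ratio u = acos u / sin (acos u).
Proof.
move=> u1; rewrite /angle_ratio /dcangle2; case/andP: (u1) => _ ->.
by field; rewrite gt_eqF// sin_acos_gt0.
Qed.

Lemma angle_ratio1 : angle_ratio 1 = 1.
Proof. by rewrite /angle_ratio /dcangle2 ltxx subrr; field. Qed.

(** Half-angle formulas: [sin t = 2 sin h cos h] and [1 + cos t = 2 cos^2 h] for [t = 2 h]. *)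
Lemma angle_ratio_half u : -1 < u < 1 -> angle_ratio u * (1 + u) / 2 =
  acos u / 2 * cos (acos u / 2) / sin (acos u / 2).
Proof.
move=> u1; rewrite angle_ratioE//; have s0 := sin_acos_gt0 u1.
have uE := cos_acos (itvoo_cc u1).
set t := acos u in s0 uE *; set h := t / 2.
have th : t = h + h by rewrite /h; field.
have sE : sin t = 2 * (sin h * cos h) by rewrite th sinD; ring.
have cE : u = 2 * cos h ^+ 2 - 1.
  by rewrite -uE th cosD -expr2 -expr2 sin2cos2; ring.
have : sin h * cos h != 0 by rewrite sE in s0; rewrite gt_eqF//; lra.
rewrite mulf_eq0 negb_or => /andP[sh ch].
by rewrite cE sE /h; field; rewrite sh ch.
Qed.

Lemma angle_ratio_gt0 u : -1 < u <= 1 -> 0 < angle_ratio u.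
Proof.
case/andP => u0; rewrite le_eqVlt => /predU1P[->|u1]; first by rewrite angle_ratio1.
have u01 : -1 < u < 1 by rewrite u0.
by rewrite angle_ratioE// divr_gt0// ?sin_acos_gt0// acos_gt0// u1 ltW.
Qed.

Lemma half_lt_pihalf t : t < pi -> t / 2 < pi / 2.
Proof. by move=> tpi; rewrite ltr_pM2r ?invr_gt0. Qed.

Lemma mul_cos_div_sin_le1 t : 0 < t < pi -> t * cos t / sin t <= 1.
Proof.
move=> t0; have st := sin_gt0_pi t0; rewrite ler_pdivrMr// mul1r.
by apply: mul_cos_le_sin; case/andP: t0 => ? ?; rewrite !ltW.
Qed.

Lemma mul_cot_half_le t u : 0 < t < pi -> -1 < u <= 1 -> acos u <= t ->
  t / 2 * cot (t / 2) <= angle_ratio u * (1 + u) / 2.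
Proof.
move=> /andP[t0 tpi] /andP[u0]; rewrite /cot mulrA le_eqVlt => /predU1P[->|u1] ut.
  rewrite angle_ratio1 mul1r (_ : (1 + 1) / 2 = 1 :> R); last by field.
  apply: mul_cos_div_sin_le1; rewrite divr_gt0//=.
  by rewrite (lt_trans (half_lt_pihalf tpi))// ltr_pdivrMr// ltr_pMr ?pi_gt0// ltr1n.
have u01 : -1 < u < 1 by rewrite u0.
rewrite angle_ratio_half//; apply: mul_cos_div_sin_nincr.
- by rewrite divr_gt0// acos_gt0// u1 ltW.
- by rewrite ler_pM2r ?invr_gt0.
- exact: half_lt_pihalf.
Qed.

(** The identity part already gives the bound by [mul_cot_half_le], so the rank-one term only has to
    be nonnegative. Its coefficient times [1 - u^2] is 1 minus the eigenvalue across the axis; at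
    [u = 1] the axial vector vanishes. *)
Lemma hesssq_ge k Q P x t : 0 <= k -> SO3 P -> SO3 Q -> -1 < cosang Q P ->
  0 < t < pi -> acos (cosang Q P) <= t ->
  k * (t / 2 * cot (t / 2)) * dot x x <= dot x (hesssq k Q P *m x).
Proof.
move=> k0 SP SQ u0 t0 ut; have /andP[_ u1] := cosang_itv SQ SP.
rewrite hesssq_form -mulrA ler_wpM2l//.
have A2 := axial_rotation (SO3M (SO3_tr SQ) SP).
have CS := cauchy_schwarz (axial (Q^T *m P)) x.
rewrite A2 -/(cosang Q P) in CS.
have m := @mul_cot_half_le t (cosang Q P) t0 (introT andP (conj u0 u1)) ut.
move: u0 u1 ut m CS; set u := cosang Q P; set d := dot (axial _) x => u0 u1 ut m CS.
have x0 := dot_ge0 x.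
suff : 0 <= (ddcangle2 u / 2 - angle_ratio u / (2 * (1 + u))) * d ^+ 2.
  by have := ler_wpM2r x0 m; lra.
move: u1; rewrite le_eqVlt => /predU1P[uE|u1].
  have -> : d ^+ 2 = 0.
    by apply/eqP; rewrite eq_le sqr_ge0 andbT (le_trans CS)// uE expr1n subrr mul0r.
  by rewrite mulr0.
have u01 : -1 < u < 1 by rewrite u0.
rewrite mulr_ge0 ?sqr_ge0//.
have w : 0 < 1 - u ^+ 2 by rewrite subr_gt0; nra.
rewrite -(pmulr_rge0 _ w).
have -> : (1 - u ^+ 2) * (ddcangle2 u / 2 - angle_ratio u / (2 * (1 + u))) =
    1 - angle_ratio u * (1 + u) / 2.
  rewrite angle_ratioE// /ddcangle2 u1 -(sin_acos2 (itvoo_cc u01)).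
  have s0 := sin_acos_gt0 u01; have s2 := sin_acos2 (itvoo_cc u01).
  rewrite cos_acos ?itvoo_cc//.
  set s := sin (acos u) in s0 s2 *; set a := acos u.
  have u1' : 1 + u != 0 by rewrite gt_eqF//; lra.
  have s0' : s != 0 by rewrite gt_eqF.
  apply/eqP; rewrite -subr_eq0; apply/eqP.
  transitivity (a / (2 * s * (1 + u)) * (1 - u ^+ 2 - s ^+ 2)).
    by field; rewrite u1' s0'.
  by rewrite s2 subrr mulr0.
rewrite subr_ge0 angle_ratio_half//; apply: mul_cos_div_sin_le1.
have a0 : 0 < acos u by rewrite acos_gt0// u1 ltW.
rewrite divr_gt0//=.
have /andP[_ api] := itv_acos (itvoo_cc u01).
by rewrite ltr_pdivrMr// (le_lt_trans api)// ltr_pMr ?pi_gt0// ltr1n.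
Qed.

Lemma norm2_gradsq k Q P : 0 <= k -> SO3 P -> SO3 Q -> -1 < cosang Q P ->
  norm2 (gradsq k Q P) = k * dist P Q.
Proof.
move=> k0 SP SQ u0; have /andP[_ u1] := cosang_itv SQ SP.
rewrite dist_acos// cosangC /gradsq norm2Z /norm2 axial_rotation; last first.
  exact: SO3M (SO3_tr SQ) SP.
rewrite -/(cosang Q P) normrM (ger0_norm k0) -mulrA; congr (_ * _).
rewrite gtr0_norm ?angle_ratio_gt0 ?u0//.
move: (cosang Q P) u0 u1 => u u0; rewrite le_eqVlt => /predU1P[->|u1].
  by rewrite expr1n subrr sqrtr0 mulr0 acos1.
have u01 : -1 < u < 1 by rewrite u0.
rewrite -sin_acos ?itvoo_cc// angle_ratioE//; field.
by rewrite gt_eqF// sin_acos_gt0.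
Qed.

End GradientHessian.

(** * Derivatives of the weighted sum of squared distances *)

Section SumOfSquaredDistances.
Context {R : realType} (N : nat) (k : 'I_N -> R) (Q : 'I_N -> 'M[R]_3).
Context (SQ : forall i, SO3 (Q i)).
Implicit Types (P : 'M[R]_3) (x : 'cV[R]_3) (t : R).

Definition sumsq P := \sum_(i < N) k i / 2 * dist P (Q i) ^+ 2.
Definition sumgrad P : 'cV[R]_3 := \sum_(i < N) gradsq (k i) (Q i) P.
Definition sumdgrad P x : 'cV[R]_3 := \sum_(i < N) dgradsq (k i) (Q i) P x.
Definition sumhess P : 'M[R]_3 := \sum_(i < N) hesssq (k i) (Q i) P.

Lemma dot_sumr n (v : 'I_n -> 'cV[R]_3) x :
  dot (\sum_(i < n) v i) x = \sum_(i < n) dot (v i) x.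
Proof.
rewrite dotE !summxE !mulr_suml -!big_split/=.
by apply: eq_bigr => i _; rewrite dotE.
Qed.

Lemma is_derive_sumsq P x t : SO3 P -> cosang_dom Q (geodesic P x t) ->
  is_derive t 1 (fun s => sumsq (geodesic P x s)) (dot (sumgrad (geodesic P x t)) x).
Proof.
move=> SP QP; rewrite /sumgrad dot_sumr.
rewrite (_ : (fun s => _) =
    \sum_(i < N) fun s => k i / 2 * cangle2 (cosang (Q i) (geodesic P x s))).
  apply: is_derive_sum => i.
  exact: is_derive1_sq_angle (is_derive_geodesic P x t) (QP i).
apply/funext => s; rewrite fct_sumE; apply: eq_bigr => i _.
by rewrite sq_dist//; exact: SO3_geodesic.
Qed.

Lemma is_derive_sumr (V : normedModType R) n (f : 'I_n -> R -> V) t (d : 'I_n -> V) :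
  (forall i, is_derive t 1 (f i) (d i)) ->
  is_derive t 1 (fun s => \sum_(i < n) f i s) (\sum_(i < n) d i).
Proof.
move=> fd; rewrite (_ : (fun s => _) = \sum_(i < n) f i); first exact: is_derive_sum.
by apply/funext => s; rewrite fct_sumE.
Qed.

Lemma is_derive_sumgrad P x t : cosang_dom Q (geodesic P x t) ->
  is_derive t 1 (fun s => sumgrad (geodesic P x s)) (sumdgrad (geodesic P x t) x).
Proof.
move=> QP; apply: is_derive_sumr => i.
exact: is_derive1_gradsq (is_derive_geodesic P x t) (QP i).
Qed.

Lemma dot_delta x i : dot x (delta_mx i 0) = x i 0.
Proof. by rewrite dotE !mxE; elim/ord3_ind: i; rewrite /=; ring. Qed.

Lemma nabla_sumsq P : SO3 P -> cosang_dom Q P -> nabla sumsq P = sumgrad P.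
Proof.
move=> SP QP; apply/matrixP => i j; rewrite (ord1 j) mxE derive1E.
have := @is_derive_sumsq P (delta_mx i 0) 0 SP; rewrite geodesic0 => /(_ QP).
by move=> /(@derive_val _ _ _ _ _ _ _) ->; rewrite dot_delta.
Qed.

Lemma sumdgrad_sumhess P x : SO3 P -> cosang_dom Q P ->
  sumdgrad P x + 2^-1 *: cross x (sumgrad P) = sumhess P *m x.
Proof.
move=> SP QP; rewrite /sumdgrad /sumgrad /sumhess mulmx_suml.
have -> : 2^-1 *: cross x (\sum_(i < N) gradsq (k i) (Q i) P) =
    \sum_(i < N) 2^-1 *: cross x (gradsq (k i) (Q i) P).
  by rewrite -hat_mul mulmx_sumr scaler_sumr; apply: eq_bigr => i _; rewrite hat_mul.
by rewrite -big_split; apply: eq_bigr => i _ /=; rewrite dgradsq_hesssq.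
Qed.

Lemma near_geodesic_dom P x : cosang_dom Q P ->
  \forall s \near (0 : R), cosang_dom Q (geodesic P x s).
Proof.
move=> QP; have := is_derive1_continuous (is_derive_geodesic P x 0).
rewrite /prop_for /continuous_at geodesic0 => /(_ _ (near_cosang_dom QP)).
by apply.
Qed.

(** After multiplication by [P^T], the derivative of [P hat g] is [hat x *m hat g] plus [hat] of the
    derivative of [g]; the skew part of the first term is [hat] of half of [cross x g]. *)
Lemma covariant_derivative_sumsq P x : SO3 P -> cosang_dom Q P ->
  covariant_derivative (grad sumsq) P x = sumhess P *m x.
Proof.
move=> SP QP; rewrite -sumdgrad_sumhess//.
have d0 := is_derive_geodesic P x 0.
have := @is_derive_sumgrad P x 0; rewrite geodesic0 => /(_ QP) d1.
have d2 := is_derive_mulmx d0 (is_derive_hat d1).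
have d3 : is_derive (0 : R) 1 (fun s => grad sumsq (geodesic P x s))
    (P *m hat x *m hat (sumgrad P) + P *m hat (sumdgrad P x)).
  move: d2; rewrite geodesic0 => d2.
  apply: (@near_eq_is_derive _ _ _
    (fun s => geodesic P x s *m hat (sumgrad (geodesic P x s)))) => //.
  apply: filterS (near_geodesic_dom x QP) => s sQ.
  by rewrite /grad nabla_sumsq//; exact: SO3_geodesic.
rewrite /covariant_derivative derive1E (@derive_val _ _ _ _ _ _ _ d3).
rewrite -[LHS]/(axial _) mulmxDr !mulmxA (SO3_tr_mul SP) !mul1mx axialD axial_hat addrC.
congr (_ + _); apply: cV3P; rewrite ?(coordE, dentE); by field.
Qed.

Lemma hessian_sumsq P : SO3 P -> cosang_dom Q P -> hessian sumsq P = sumhess P.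
Proof.
move=> SP QP; apply/matrixP => i j; rewrite mxE covariant_derivative_sumsq//.
rewrite mulmx3E !mxE; elim/ord3_ind: j; rewrite /=; ring.
Qed.

Lemma sumhess_tr P : (sumhess P)^T = sumhess P.
Proof. by rewrite /sumhess linear_sum/=; apply: eq_bigr => i _; rewrite hesssq_tr. Qed.

Lemma sumhess_ge P x t : (forall i, 0 < k i) -> SO3 P -> cosang_dom Q P ->
  0 < t < pi -> (forall i, dist P (Q i) <= t) ->
  (\sum_(i < N) k i) * (t / 2 * cot (t / 2)) * dot x x <= dot (sumhess P *m x) x.
Proof.
move=> k0 SP QP t0 dt; rewrite /sumhess mulmx_suml dot_sumr -mulrA mulr_suml.
apply: ler_sum => i _; rewrite mulrA dotC; apply: hesssq_ge => //.
  exact: ltW.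
by have := dt i; rewrite dist_acos// cosangC.
Qed.

(** The frame correction is orthogonal to [x], so second derivatives along geodesics are values of
    the Hessian form. *)
Lemma dot_sumdgrad P x : SO3 P -> cosang_dom Q P ->
  dot (sumdgrad P x) x = dot (sumhess P *m x) x.
Proof.
move=> SP QP; rewrite -sumdgrad_sumhess// dotDl dotZl.
have -> : dot (cross x (sumgrad P)) x = 0 by rewrite !coordE; ring.
by rewrite mulr0 addr0.
Qed.

Lemma is_derive_sumsq2 P x t : SO3 P -> cosang_dom Q (geodesic P x t) ->
  is_derive t 1 (fun s => dot (sumgrad (geodesic P x s)) x)
    (dot (sumhess (geodesic P x t) *m x) x).
Proof.
move=> SP QP; rewrite -dot_sumdgrad//; last exact: SO3_geodesic.
have /is_derive_mxP d := is_derive_sumgrad QP.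
have d0 := d 0 0; have d1 := d 1 0; have d2 := d 2 0.
under eq_fun do rewrite dotE.
by apply: is_derive_eq; rewrite dotE /GRing.scale/=; ring.
Qed.

End SumOfSquaredDistances.

Section SquaredDistance.
Context {R : realType}.
Implicit Types (P Q : 'M[R]_3) (k : R).

(** Results on sums specialize to a single [f_i] through a one-term sum. *)
Lemma sumsq1 k Q : (fun P => k / 2 * dist P Q ^+ 2) =
  sumsq (fun _ : 'I_1 => k) (fun=> Q).
Proof. by apply/funext => P; rewrite /sumsq big_ord1. Qed.

Lemma nabla_sq k Q P : SO3 P -> SO3 Q -> -1 < cosang Q P ->
  nabla (fun P => k / 2 * dist P Q ^+ 2) P = gradsq k Q P.
Proof.
by move=> SP SQ u0; rewrite sumsq1 nabla_sumsq// /sumgrad big_ord1.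
Qed.

End SquaredDistance.

(** * Triangles in SO(3) *)

Section Geometry.
Context {R : realType}.
Implicit Types (P Q S : 'M[R]_3) (x n : 'cV[R]_3) (r t : R).

Lemma dist_ge0 P Q : SO3 P -> SO3 Q -> 0 <= dist P Q.
Proof. by move=> SP SQ; rewrite dist_acos// acos_ge0// cosang_itv. Qed.

Lemma dist_lepi P Q : SO3 P -> SO3 Q -> dist P Q <= pi.
Proof. by move=> SP SQ; rewrite dist_acos// acos_lepi// cosang_itv. Qed.

Lemma dist_sym P Q : SO3 P -> SO3 Q -> dist P Q = dist Q P.
Proof. by move=> SP SQ; rewrite !dist_acos// cosangC. Qed.

Lemma dist_le_cosang P Q r : SO3 P -> SO3 Q -> 0 <= r <= pi ->
  (dist P Q <= r) = (cos r <= cosang P Q).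
Proof.
move=> SP SQ r0; rewrite dist_acos// -{1}(acos_cos r0) acos_le//.
  exact: cosang_itv.
by rewrite cos_geN1 cos_le1.
Qed.

Lemma dist_lt_cosang P Q r : SO3 P -> SO3 Q -> 0 <= r <= pi ->
  (dist P Q < r) = (cos r < cosang P Q).
Proof.
move=> SP SQ r0; rewrite dist_acos// -{1}(acos_cos r0) acos_lt//.
  exact: cosang_itv.
by rewrite cos_geN1 cos_le1.
Qed.

Lemma cosang_gtN1 P Q : SO3 P -> SO3 Q -> (-1 < cosang P Q) = (dist P Q < pi).
Proof. by move=> SP SQ; rewrite dist_lt_cosang// ?cospi// pi_ge0 lexx. Qed.

(** Two minimal geodesics joined at [Q] form an admissible piecewise curve. *)
Lemma dist_triangle P Q S : SO3 P -> SO3 Q -> SO3 S ->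
  dist P S <= dist P Q + dist Q S.
Proof.
move=> SP SQ SS; have [x [xQ nx]] := minimal_geodesic SP SQ.
have [y [yS ny]] := minimal_geodesic SQ SS.
rewrite [dist P Q]dist_acos// [dist Q S]dist_acos// -nx -ny dist_acos// cosangC.
rewrite -(curve_length_geodesic x SP) -(curve_length_geodesic y SQ).
have := @joins_length_ge _ [:: geodesic P x; geodesic Q y] P S SP SS.
rewrite big_cons big_seq1; apply; rewrite /= xQ !geodesic0.
by split=> //; [exact: C1_curve_geodesic|move=> *; exact: SO3_geodesic|
  split=> //; [exact: C1_curve_geodesic|move=> *; exact: SO3_geodesic]].
Qed.

Lemma rot_dist P Q : SO3 P -> SO3 Q ->
  exists n, dot n n = 1 /\ P^T *m Q = rot (dist P Q) n.
Proof.
move=> SP SQ; have [t [n [n1 t0 E]]] := rot_exists (SO3M (SO3_tr SP) SQ).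
by exists n; split => //; rewrite dist_acos// (cosang_rot n1 E) acos_cos.
Qed.

(** [Q^T S] is the product of [(P^T Q)^T], a rotation about [- n], and [P^T S]: the law of cosines
    in the triangle with apex [P]. *)
Lemma cosang_rot_rot s t n m P Q S : dot n n = 1 -> dot m m = 1 -> SO3 P ->
  P^T *m Q = rot s n -> P^T *m S = rot t m ->
  cosang Q S = 2 * (cos (s / 2) * cos (t / 2)
    + sin (s / 2) * sin (t / 2) * dot n m) ^+ 2 - 1.
Proof.
move=> n1 m1 SP EQ ES; rewrite /cosang.
have -> : Q^T *m S = rot s (- n) *m rot t m.
  rewrite -ES /rot axrotN -axrot_tr -/(rot s n) -EQ trmx_mul trmxK.
  by rewrite mulmxA -(mulmxA Q^T) (SO3_mul_tr SP) mulmx1.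
have n1' : dot (- n) (- n) = 1 by rewrite -n1 !dotE !mxoppE; ring.
rewrite tr_rotM//.
have -> : dot (- n) m = - dot n m by rewrite !dotE !mxoppE; ring.
by field.
Qed.

Lemma cos_half2 t : cos t = 2 * cos (t / 2) ^+ 2 - 1.
Proof.
rewrite {1}(_ : t = t / 2 + t / 2); last by field.
by rewrite cosD -!expr2 sin2cos2; ring.
Qed.

Lemma cos_half_gt0 t : 0 <= t < pi -> 0 < cos (t / 2).
Proof.
move=> /andP[t0 tpi]; apply: cos_gt0_half.
by rewrite divr_ge0//= ltr_pM2r ?invr_gt0.
Qed.

Lemma sin_half_ge0 t : 0 <= t <= pi -> 0 <= sin (t / 2).
Proof.
move=> /andP[t0 tpi]; apply: sin_ge0_pi; rewrite divr_ge0//=.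
by rewrite (le_trans _ tpi)// ler_pdivrMr// ler_peMr// ler1n.
Qed.

Lemma dot_unit_le1 n m : dot n n = 1 -> dot m m = 1 -> -1 <= dot n m <= 1.
Proof.
move=> n1 m1; have := cauchy_schwarz n m; rewrite n1 m1 mulr1.
by move=> H; apply/andP; split; nra.
Qed.

Lemma pihalf_lt_pi : pi / 2 < pi :> R.
Proof. by rewrite ltr_pdivrMr// ltr_pMr ?pi_gt0// ltr1n. Qed.

(* On the unit quaternions the half-angle cosine between S and Q is the inner
   product q; if the angle at P were not acute, |q| could not exceed cos (s/2). *)
Lemma dot_axis_axial_gt0 P S Q n s : SO3 P -> SO3 S -> SO3 Q ->
  dot n n = 1 -> 0 < s < pi / 2 -> P^T *m S = rot s n ->
  dist S Q < s -> dist P Q < pi -> 0 < dot n (axial (P^T *m Q)).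
Proof.
move=> SP SS SQ n1 /andP[s0 s2] ES dSQ dPQ.
have [m [m1 EQ]] := rot_dist SP SQ.
set t := dist P Q in dPQ EQ; have t0 : 0 <= t by exact: dist_ge0.
have spi : s < pi by rewrite (lt_trans s2)// pihalf_lt_pi.
have := dist_lt_cosang (r := s) SS SQ; rewrite !ltW// => /(_ isT).
rewrite dSQ (cosang_rot_rot n1 m1 SP ES EQ) cos_half2 => /esym qw.
have cs : 0 < cos s by rewrite cos_gt0_half// ltW.
have w0 : 0 < cos (s / 2) by rewrite cos_half_gt0// ltW.
have p0 : 0 < cos (t / 2) by rewrite cos_half_gt0// t0.
have p1 := cos_le1 (t / 2).
have z0 : 0 <= sin (s / 2) by rewrite sin_half_ge0// !ltW.
have y0 : 0 <= sin (t / 2) by rewrite sin_half_ge0// t0 ltW.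
have y1 := sin_le1 (t / 2).
have z2 := sin2cos2 (s / 2); rewrite cos_half2 in cs.
have /andP[nm1 nm2] := dot_unit_le1 n1 m1.
rewrite EQ axial_axrot dotZr.
have -> : sin t * dot n m = 2 * cos (t / 2) * (sin (t / 2) * dot n m).
  by rewrite {1}(_ : t = t / 2 + t / 2) ?sinD; [ring|field].
rewrite pmulr_rgt0; last by rewrite mulr_gt0.
rewrite ltNge; apply/negP; rewrite -mulrA in qw.
have : -1 <= sin (t / 2) * dot n m by nra.
move: (sin (t / 2) * dot n m) qw => y qw ym y00.
move: (cos (s / 2)) (sin (s / 2)) (cos (t / 2)) w0 p0 p1 z0 z2 cs qw.
move=> w z p w0 p0 p1 z0 z2 cs qw.
have zw : z < w by nra.
have q1 : w * p + z * y <= w by nra.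
have q2 : - w <= w * p + z * y by nra.
by move: (w * p + z * y) q1 q2 qw => q *; nra.
Qed.

Lemma unit_log_towardE P S n s : dot n n = 1 -> 0 < s < pi ->
  P^T *m S = rot s n -> unit_log_toward S P = n.
Proof.
move=> n1 s0 E; rewrite /unit_log_toward E logm_rot// veeK norm2Z norm2_unit// mulr1.
case/andP: s0 => s0 _; rewrite gtr0_norm// scalerA mulVf ?scale1r//.
by rewrite gt_eqF.
Qed.

Lemma gradsq_axial k Q P : gradsq k Q P =
  - (k * angle_ratio (cosang Q P)) *: axial (P^T *m Q).
Proof.
rewrite /gradsq scaleNr -scalerN -axial_tr trmx_mul trmxK.
by [].
Qed.

Lemma dot_axis_gradsq_lt0 k P S Q n s : 0 < k -> SO3 P -> SO3 S -> SO3 Q ->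
  dot n n = 1 -> 0 < s < pi / 2 -> P^T *m S = rot s n ->
  dist S Q < s -> dist P Q < pi -> dot n (gradsq k Q P) < 0.
Proof.
move=> k0 SP SS SQ n1 s0 E dSQ dPQ.
rewrite gradsq_axial dotZr mulNr oppr_lt0 mulr_gt0//.
  rewrite mulr_gt0// angle_ratio_gt0//.
  by case/andP: (cosang_itv SQ SP) => _ ->; rewrite cosang_gtN1// dist_sym// dPQ.
exact: (dot_axis_axial_gt0 SP SS SQ n1 s0 E).
Qed.

End Geometry.

(** * Geodesic convexity of balls of radius below [pi / 2] *)

Section Ball.
Context {R : realType}.
Implicit Types (P Q S : 'M[R]_3) (x n : 'cV[R]_3) (r t : R).

(* [w cos s + z sin s] is, up to sign, the half-angle cosine along an arc. *)
Lemma arc_ge (c w z a t : R) : 0 < c -> 2^-1 < c ^+ 2 -> c <= w ->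
  w ^+ 2 + z ^+ 2 <= 1 -> c ^+ 2 <= (w * cos a + z * sin a) ^+ 2 ->
  0 <= a < pi / 2 -> 0 <= t <= 1 -> c <= w * cos (t * a) + z * sin (t * a).
Proof.
move=> c0 c2 cw wz cW /andP[a0 a2] /andP[t0 t1].
have [a00|an0] := eqVneq a 0; first by rewrite a00 mulr0 cos0 sin0 mulr0 addr0 mulr1.
have ap : 0 < a by rewrite lt_neqAle eq_sym an0.
have sa : 0 < sin a by rewrite sin_gt0_pihalf// ap.
have ca : 0 < cos a by rewrite cos_gt0_half// a0.
have sa1 := sin_le1 a.
(* Only the square of the end value is bounded below. Since [z^2 <= 1 - c^2 < c^2], the end value
   exceeds [- c], which leaves the positive alternative. *)
have W1 : c <= w * cos a + z * sin a.
  have zc : z ^+ 2 < c ^+ 2 by nra.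
  have /andP[zc1 zc2] : - c < z < c by apply/andP; split; nra.
  have zs : - c < z * sin a by nra.
  have wc : 0 < w * cos a by rewrite mulr_gt0//; lra.
  have : - c < w * cos a + z * sin a by lra.
  by move: (w * cos a + z * sin a) cW => W *; nra.
(* Multiplied by [sin a], the value at [t a] combines the two end values with weights
   [sin ((1 - t) a)] and [sin (t a)], whose sum is at least [sin a]. *)
rewrite -(ler_pM2l sa).
have spi (x : R) : 0 <= x <= a -> 0 <= sin x.
  move=> /andP[x0 xa]; rewrite sin_ge0_pi// x0 (le_trans xa)// ltW//.
  by rewrite (lt_trans a2)// pihalf_lt_pi.
have s1 : 0 <= sin ((1 - t) * a) by apply: spi; nra.
have s2 : 0 <= sin (t * a) by apply: spi; nra.
have c1 := cos_le1 ((1 - t) * a); have c3 := cos_le1 (t * a).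
have E1 : sin a = sin ((1 - t) * a) * cos (t * a) + cos ((1 - t) * a) * sin (t * a).
  by rewrite -sinD; congr sin; ring.
have E2 : sin ((1 - t) * a) = sin a * cos (t * a) - cos a * sin (t * a).
  by rewrite -sinB; congr sin; ring.
have -> : sin a * (w * cos (t * a) + z * sin (t * a)) =
    sin ((1 - t) * a) * w + sin (t * a) * (w * cos a + z * sin a).
  by rewrite E2; ring.
have : sin a <= sin ((1 - t) * a) + sin (t * a).
  by rewrite {1}E1; nra.
by move: (w * cos a + z * sin a) W1 => W W1; nra.
Qed.

Lemma cos_le (a b : R) : 0 <= a -> a <= b -> b <= pi -> cos b <= cos a.
Proof.
move=> a0 ab bpi; rewrite leNgt ltr_cos ?in_itv/= -?leNgt//.
- by rewrite bpi (le_trans a0).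
- by rewrite a0 (le_trans ab).
Qed.

(** The axial vector of [P^T Q] is [sin d] times the unit direction, so it determines the velocity
    whenever [0 < d < pi]; at [d = 0] the velocity has norm 0. *)
Lemma minimizing_unique P Q x y : SO3 P -> SO3 Q -> dist P Q < pi ->
  minimizing P Q x -> minimizing P Q y -> x = y.
Proof.
move=> SP SQ dpi.
have main v : minimizing P Q v -> sin (dist P Q) *: v = dist P Q *: axial (P^T *m Q).
  move=> [vQ nv]; have [n [n1 E]] := cV3_polar v.
  rewrite nv in E; have EQ : P^T *m Q = rot (dist P Q) n.
    by rewrite -[in LHS]vQ {1}E geodesic_rot// mul1r mulmxA (SO3_tr_mul SP) mul1mx.
  by rewrite EQ axial_axrot {1}E !scalerA mulrC.
have d0 := dist_ge0 SP SQ.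
have [E|dn0] := eqVneq (dist P Q) 0.
  by move=> [_ +] [_ +]; rewrite E => /norm2_eq0 -> /norm2_eq0 ->.
have s0 : sin (dist P Q) != 0.
  by rewrite gt_eqF// sin_gt0_pi// dpi lt_neqAle eq_sym dn0 d0.
by move=> /main E1 /main E2; apply: (scalerI s0); rewrite E1 E2.
Qed.

(** Points of the ball are at distance at most [2 r < pi], whence uniqueness. Seen from [A], the law
    of cosines gives the half-angle cosine to the centre the form treated in [arc_ge], and
    [r < pi / 2] supplies [1/2 < cos^2 (r/2)]. *)
Lemma closed_ball_convex P r : SO3 P -> 0 < r < pi / 2 ->
  geodesically_convex (closed_ball_SO3 P r).
Proof.
move=> SP /andP[r0 r2]; split; first by move=> Q [].
have rpi : 0 <= r <= pi by rewrite ltW//= (le_trans (ltW r2))// ltW// pihalf_lt_pi.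
move=> A B [SA dA] [SB dB].
have dAB : dist A B < pi.
  rewrite (le_lt_trans (dist_triangle SA SP SB))// [dist P B]dist_sym//; lra.
have [x [xB nx]] := minimal_geodesic SA SB.
have mx : minimizing A B x by split; rewrite // dist_acos.
split.
  by exists x; split => // y my; exact: (minimizing_unique SA SB dAB).
move=> y t my t01; split; first exact: SO3_geodesic.
have {x xB nx mx} [yB ny] := my.
have [m [m1 Em]] := cV3_polar y; rewrite ny in Em.
have [n [n1 En]] := rot_dist SA SP.
have EG s : A^T *m geodesic A y s = rot (s * dist A B) m.
  by rewrite {1}Em geodesic_rot// mulmxA (SO3_tr_mul SA) mul1mx.
have EW s := cosang_rot_rot n1 m1 SA En (EG s).
rewrite dist_le_cosang//; last exact: SO3_geodesic.
have d0 : 0 <= dist A P by exact: dist_ge0.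
have cr : 0 < cos r by rewrite cos_gt0_half// ltW.
have c0 : 0 < cos (r / 2).
  by rewrite cos_half_gt0// ltW//= (lt_trans r2)// pihalf_lt_pi.
have c2 : 2^-1 < cos (r / 2) ^+ 2 by move: cr; rewrite cos_half2; lra.
have /andP[nm1 nm2] := dot_unit_le1 n1 m1.
rewrite cosangC EW cos_half2.
set w := cos (dist A P / 2) in EW *.
have cw : cos (r / 2) <= w.
  have dpi : dist A P <= pi by exact: dist_lepi.
  by apply: cos_le; [rewrite divr_ge0|rewrite ler_pM2r ?invr_gt0|lra].
pose z := sin (dist A P / 2) * dot n m.
have wz : w ^+ 2 + z ^+ 2 <= 1.
  have := cos2Dsin2 (dist A P / 2); rewrite -/w /z exprMn.
  have := sqr_ge0 (sin (dist A P / 2)).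
  have : dot n m ^+ 2 <= 1 by nra.
  by move: (sin _ ^+ 2) => v; nra.
have dAB0 : 0 <= dist A B by exact: dist_ge0.
have EW' s : cosang P (geodesic A y s) =
    2 * (w * cos (s * (dist A B / 2)) + z * sin (s * (dist A B / 2))) ^+ 2 - 1.
  by rewrite EW /z mulrA; congr (2 * _ ^+ 2 - 1); ring.
have cW : cos (r / 2) ^+ 2 <=
    (w * cos (dist A B / 2) + z * sin (dist A B / 2)) ^+ 2.
  have := EW' 1; rewrite yB !mul1r => E.
  by move: dB; rewrite dist_le_cosang// cosangC E cos_half2; lra.
have a2 : 0 <= dist A B / 2 < pi / 2.
  by rewrite divr_ge0//=; exact: half_lt_pihalf.
have := arc_ge c0 c2 cw wz cW a2 t01.
have := EW' t; rewrite EW => H1 H2.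
by rewrite H1; move: (w * _ + _) H2 => W; nra.
Qed.

End Ball.

(** * Compactness of balls *)

Section Compactness.
Context {R : realType}.
Implicit Types (P Q : 'M[R]_3) (r : R).

(** Heine-Borel for row vectors, transported by the continuous bijection [vec_mx]. *)
Lemma compact_mx m p (A : set 'M[R]_(m, p)) (b : R) : 0 <= b -> closed A ->
  (forall M, A M -> forall i j, `|M i j| <= b) -> compact A.
Proof.
move=> b0 cA bA.
have cv : continuous (@vec_mx R m p).
  move=> v; have Fv : Filter (nbhs v) := nbhs_filter v.
  apply: cvg_mxP => i j; rewrite mxE.
  under eq_cvg do rewrite mxE.
  exact: coord_continuous.
have -> : A = vec_mx @` (vec_mx @^-1` A).
  apply/seteqP; split => [M AM|_ [v Av <-]//].
  by exists (mxvec M); rewrite /= mxvecK.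
apply: continuous_compact; first exact: continuous_subspaceT.
apply: bounded_closed_compact; last first.
  by apply: closed_comp => // v _; exact: cv.
exists b; split; first exact: num_real.
move=> c bc v /= Av.
have c0 : 0 <= c by rewrite (le_trans b0)// ltW.
rewrite [leLHS]/Num.Def.normr/= mx_normrE (bigmax_le _ c0)//= => -[i k] _ /=.
rewrite (ord1 i); case/mxvec_indexP: k => i' j'.
by have := bA _ Av i' j'; rewrite mxE => /le_trans; apply; exact: ltW.
Qed.

Lemma closed_SO3 : closed (@SO3 R).
Proof.
have -> : @SO3 R = \bigcap_(i in [set: 'I_3]) \bigcap_(j in [set: 'I_3])
    ((fun P => (P^T *m P) i j) @^-1` [set (1%:M : 'M[R]_3) i j])
   `&` (determinant @^-1` [set 1]).
  apply/seteqP; split => P.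
    by move=> [PP dP]; split => // i _ j _; rewrite /= PP.
  move=> [PP dP]; split => //; apply/matrixP => i j; exact: (PP i I j I).
have c (P : 'M[R]_3) i j : {for P, continuous (fun A : 'M[R]_3 => A i j)}.
  exact: coord_continuous.
apply: closedI.
  apply: closed_bigI => i _; apply: closed_bigI => j _.
  apply: closed_comp; last exact: closed_eq.
  move=> P _; have FP : Filter (nbhs P) := nbhs_filter P.
  rewrite (_ : (fun _ => _) =
      fun P : 'M[R]_3 => P 0 i * P 0 j + P 1 i * P 1 j + P 2 i * P 2 j).
    by apply: cvgD; [apply: cvgD|]; apply: cvgM; exact: c.
  by apply/funext => A; rewrite mulmx3E !mxtrE.
apply: closed_comp; last exact: closed_eq.
move=> P _; have FP : Filter (nbhs P) := nbhs_filter P.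
rewrite (_ : determinant = fun A : 'M[R]_3 => A 0 0 * (A 1 1 * A 2 2 - A 1 2 * A 2 1)
  - A 0 1 * (A 1 0 * A 2 2 - A 1 2 * A 2 0)
  + A 0 2 * (A 1 0 * A 2 1 - A 1 1 * A 2 0)); last first.
  by apply/funext => A; rewrite det3E.
apply: cvgD; [apply: cvgB|]; apply: cvgM; try exact: c;
  by apply: cvgB; apply: cvgM; exact: c.
Qed.

Lemma SO3_entry_le1 P i j : SO3 P -> `|P i j| <= 1.
Proof.
move=> SP; have := congr1 (fun M : 'M[R]_3 => M j j) (SO3_tr_mul SP).
rewrite /= mulmx3E !mxtrE mxE eqxx /= => E.
have : P i j ^+ 2 <= 1.
  rewrite -[leRHS]E; elim/ord3_ind: i; rewrite -!expr2;
  by have := sqr_ge0 (P 0 j); have := sqr_ge0 (P 1 j); have := sqr_ge0 (P 2 j); lra.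
by rewrite ler_norml; nra.
Qed.

Lemma compact_ball P r : SO3 P -> 0 <= r <= pi -> compact (closed_ball_SO3 P r).
Proof.
move=> SP rpi; have -> : closed_ball_SO3 P r =
    @SO3 R `&` (cosang P @^-1` [set u | cos r <= u]).
  by apply/seteqP; split => Q [SQ] /=; rewrite /closed_ball_SO3 /= dist_le_cosang// cosangC.
apply: (@compact_mx _ _ _ 1) => //.
  apply: closedI; first exact: closed_SO3.
  apply: closed_comp; last exact: closed_ge.
  by move=> Q _; exact: continuous_cosang.
by move=> Q [SQ _] i j; exact: SO3_entry_le1.
Qed.

End Compactness.

(** * Minima of functions of one real variable *)

Lemma is_derive_ge0_at_min (R : realType) (G : R -> R) (s d : R) :
  is_derive (0 : R) 1 G d -> 0 < s -> (forall t, 0 <= t <= s -> G 0 <= G t) -> 0 <= d.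
Proof.
move=> Gd s0 Gmin; rewrite leNgt; apply/negP => d0.
have [g [Eg cg g0]] := (is_derive1_caratheodory _ _ _).1 Gd.
(* The slope function is continuous and negative at 0, so [G] would fall below [G 0] at a small
   positive [z], chosen within [[0, s]]. *)
have : \forall z \near 0, g z < 0.
  have cg' : g z @[z --> 0] --> d by rewrite -g0.
  exact: (cg' _ (lt_nbhsl d0)).
move=> [e /= e0 eg].
pose z := Num.min e s / 2.
have m0 : 0 < Num.min e s by rewrite lt_min e0.
have z0 : 0 < z by rewrite divr_gt0.
have [ze zs] : z < e /\ z <= s.
  have : Num.min e s <= e by rewrite ge_min lexx.
  have : Num.min e s <= s by rewrite ge_min lexx orbT.
  by rewrite /z; split; lra.
have gz : g z < 0 by apply: eg; rewrite /= sub0r normrN gtr0_norm.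
have := Eg z; have := Gmin z; rewrite ltW// zs => /(_ isT); rewrite subr0.
by nra.
Qed.

(* The derivative vanishes somewhere inside, hence is negative before. *)
Lemma no_min_at_both_ends (R : realType) (G dG ddG : R -> R) :
  (forall t : R, 0 <= t <= 1 -> is_derive t 1 G (dG t)) ->
  (forall t : R, 0 <= t <= 1 -> is_derive t 1 dG (ddG t)) ->
  (forall t : R, 0 <= t <= 1 -> 0 < ddG t) ->
  (forall t : R, 0 <= t <= 1 -> G 0 <= G t) -> G 0 <> G 1.
Proof.
move=> D1 D2 pos Gmin G01.
have cont (f df : R -> R) (a b : R) : 0 <= a -> b <= 1 ->
    (forall t : R, 0 <= t <= 1 -> is_derive t 1 f (df t)) -> {within `[a, b], continuous f}.
  move=> a0 b1 fD; apply: derivable_within_continuous => t /[!in_itv]/= /andP[ta tb].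
  have t01 : 0 <= t <= 1 by rewrite (le_trans a0) ?(le_trans tb).
  exact: (@ex_derive _ _ _ _ _ _ _ (fD t t01)).
have mvt (f df : R -> R) (a b : R) : 0 <= a -> a < b -> b <= 1 ->
    (forall t : R, 0 <= t <= 1 -> is_derive t 1 f (df t)) ->
    exists2 c, a < c < b & f b - f a = df c * (b - a).
  move=> a0 ab b1 fD; have [||c] := @MVT R f df a b ab.
  - move=> t /[!in_itv]/= /andP[at' tb]; apply: fD.
    by rewrite (le_trans a0) ?ltW// (lt_le_trans tb).
  - exact: cont fD.
  - by move=> /[!in_itv]/= cab ->; exists c.
have [c /andP[c0 c1]] := mvt G dG 0 1 (lexx _) ltr01 (lexx _) D1.
rewrite G01 subrr subr0 mulr1 => dGc.
have [d /andP[d0 dc] E] := mvt G dG 0 c (lexx _) c0 (ltW c1) D1.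
have [e /andP[de ec] E2] := mvt dG ddG d c (ltW d0) dc (ltW c1) D2.
have e01 : 0 <= e <= 1 by rewrite !ltW ?(lt_trans d0) ?(lt_trans ec).
have pe := pos e e01.
have c01 : 0 <= c <= 1 by rewrite !ltW.
have := Gmin c c01.
have : dG d < 0 by nra.
by nra.
Qed.

(** * The ball around [Rc] and the minimizer of the sum *)

Section MainTheorem.
Context {R : realType} (n : nat) (Rc : 'M[R]_3) (rho r0 : R).
Context (k : 'I_n -> R) (Rs : 'I_n -> 'M[R]_3).
Context (n0 : (0 < n)%N) (SRc : SO3 Rc) (rho0 : 0 < rho < pi / 2).
Context (r00 : 0 <= r0 < rho) (k0 : forall i, 0 < k i).
Context (SRs : forall i, SO3 (Rs i)) (dRs : forall i, dist (Rs i) Rc <= r0).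

Local Notation C := (closed_ball_SO3 Rc rho).
Local Notation F := (sumsq k Rs).
Implicit Types (P Q : 'M[R]_3).

Lemma rho_pi : 0 <= rho <= pi.
Proof.
case/andP: rho0 => r1 r2; rewrite ltW//= ltW// (lt_trans r2)// pihalf_lt_pi //.
Qed.

Lemma rho_r0 : 0 < rho + r0 < pi.
Proof. by case/andP: rho0 => ? ?; case/andP: r00 => ? ?; lra. Qed.

Lemma ball_dist P i : C P -> dist P (Rs i) <= rho + r0.
Proof.
move=> [SP dP]; rewrite (le_trans (dist_triangle SP SRc (SRs i)))// lerD//.
by rewrite dist_sym.
Qed.

Lemma ball_dom P : C P -> cosang_dom Rs P.
Proof.
move=> CP i; have [SP _] := CP.
rewrite cosang_gtN1// dist_sym// (le_lt_trans (ball_dist i CP))//.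
by case/andP: rho_r0.
Qed.

Definition cosang_nbhd : set 'M[R]_3 := @SO3 R `&` cosang_dom Rs.

Lemma open_cosang_nbhd : open_SO3 cosang_nbhd.
Proof.
split; first by move=> P [].
apply/open_subspaceP; exists (cosang_dom Rs); first exact: open_cosang_dom.
by apply/seteqP; split => P /=; [move=> [? ?]|move=> [[? ?] ?]].
Qed.

Lemma ball_nbhd : C `<=` cosang_nbhd.
Proof. by move=> P CP; split; [case: CP|exact: ball_dom]. Qed.

Lemma C2_on_sq i : C2_on (fun P => k i / 2 * dist P (Rs i) ^+ 2) cosang_nbhd.
Proof.
rewrite sumsq1; by apply: C2_on_sum_sq_dist => // P [SP dP].
Qed.

Lemma boundary_inward i P : SO3 P -> dist P Rc = rho ->
  dot (unit_log_toward Rc P) (nabla (fun P => k i / 2 * dist P (Rs i) ^+ 2) P) <= 0.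
Proof.
move=> SP dP; have CP : C P by split; rewrite ?dP.
have [m [m1 E]] := rot_dist SP SRc; rewrite dP in E.
have rpi : 0 < rho < pi by case/andP: rho0 => -> r2; rewrite (lt_trans r2)// pihalf_lt_pi.
rewrite (unit_log_towardE m1 rpi E) nabla_sq//; last exact: ball_dom.
apply/ltW/(dot_axis_gradsq_lt0 (k0 i) SP SRc (SRs i) m1 rho0 E).
  by rewrite dist_sym// (le_lt_trans (dRs i))//; case/andP: r00.
by rewrite (le_lt_trans (ball_dist i CP))//; case/andP: rho_r0.
Qed.

Lemma norm_nabla i P : C P ->
  norm2 (nabla (fun P => k i / 2 * dist P (Rs i) ^+ 2) P) = k i * dist P (Rs i).
Proof.
move=> CP; have [SP _] := CP; have u0 := ball_dom CP i.
by rewrite nabla_sq// norm2_gradsq// ltW.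
Qed.

Lemma ball_center : C Rc.
Proof.
split=> //; rewrite dist_le_cosang// ?rho_pi//.
rewrite /cosang SO3_tr_mul// mxtrace1 (_ : (3%:R - 1) / 2 = 1); last by field.
exact: cos_le1.
Qed.

Lemma compact_center_ball : compact C.
Proof. by apply: compact_ball => //; exact: rho_pi. Qed.

(** Maximizing the distance amounts to minimizing its cosine, which is continuous on all
    matrices. *)
Lemma farthest_in_ball i : exists2 P, C P & forall Q, C Q -> dist Q (Rs i) <= dist P (Rs i).
Proof.
have [||P] := @compact_EVT_min _ R (cosang (Rs i)) C _ compact_center_ball.
- by exists Rc; exact: ball_center.
- by apply: continuous_subspaceT; exact: continuous_cosang.
rewrite inE => CP Pmin; exists P => // Q CQ.
have [SP _] := CP; have [SQ _] := CQ.
rewrite !dist_acos// acos_le ?cosang_itv//.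
by rewrite ![cosang _ (Rs i)]cosangC; apply: Pmin; rewrite inE.
Qed.

(** For each [i] the gradient norm is largest at a farthest point of the ball; the largest of these
    finitely many values is attained, [0 < n] providing an index. *)
Lemma max_grad_norm : exists2 m, is_maximum
    [set y | exists i P, C P /\
       y = norm2 (nabla (fun P => k i / 2 * dist P (Rs i) ^+ 2) P)] m
  & m <= \big[Num.max/0]_(i < n) (k i * (rho + r0)).
Proof.
have far i := cid2 (farthest_in_ball i).
pose w i := s2val (far i).
have wC i : C (w i) := s2valP (far i).
have wmax i Q : C Q -> dist Q (Rs i) <= dist (w i) (Rs i) := s2valP' (far i) Q.
pose v i := k i * dist (w i) (Rs i).
have [j _ jmax] := @Order.TotalTheory.arg_maxP _ _ 'I_n (Ordinal n0) xpredT v isT.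
exists (v j).
  split; first by exists j, (w j); rewrite norm_nabla.
  move=> _ [i [P [CP ->]]]; rewrite norm_nabla// (le_trans _ (jmax i isT))//.
  by rewrite ler_pM2l//; exact: wmax.
rewrite (le_trans (_ : v j <= k j * (rho + r0)))//.
  by rewrite ler_pM2l//; exact: ball_dist.
exact: (le_bigmax _ (fun i => k i * (rho + r0)) j).
Qed.

Let mu := (\sum_(i < n) k i) * ((rho + r0) / 2) * cot ((rho + r0) / 2).

Lemma mu_gt0 : 0 < mu.
Proof.
rewrite /mu; case/andP: rho_r0 => r1 r2.
have h : (rho + r0) / 2 < pi / 2 by exact: half_lt_pihalf.
have h0 : 0 < (rho + r0) / 2 by rewrite divr_gt0.
have sc : 0 < cot ((rho + r0) / 2).
  by rewrite divr_gt0 ?sin_gt0_pihalf ?h0// cos_gt0_half// ltW.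
rewrite mulr_gt0// mulr_gt0// (bigD1 (Ordinal n0))//= ltr_pwDl// sumr_ge0// => i _; exact: ltW.
Qed.

Lemma sumhess_ball P x : C P -> mu * dot x x <= dot (sumhess k Rs P *m x) x.
Proof.
move=> CP; have [SP _] := CP.
rewrite /mu -(mulrA (\sum_(i < n) k i)); apply: sumhess_ge => //.
- exact: ball_dom.
- exact: rho_r0.
- by move=> i; exact: ball_dist.
Qed.

Lemma strongly_convex : geodesically_strongly_convex mu F C.
Proof.
split; first exact: closed_ball_convex.
  exists cosang_nbhd; split; [exact: open_cosang_nbhd|exact: ball_nbhd|].
  by apply: C2_on_sum_sq_dist => // P [].
move=> P CP; have [SP _] := CP; rewrite hessian_sumsq//; last exact: ball_dom.
split; first by rewrite linearB/= sumhess_tr tr_scalar_mx.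
move=> x; rewrite mulmxBr mulmxBl mxE [X in _ + X]mxE -mulmxA mul_mx_scalar -scalemxAl.
rewrite [X in _ - X]mxE -!/(dot _ _) dotC subr_ge0.
exact: sumhess_ball.
Qed.

Lemma continuous_sumsq : {within C, continuous F}.
Proof.
pose g A := \sum_(i < n) k i / 2 * cangle2 (cosang (Rs i) A).
apply: (@subspace_eq_continuous _ _ _ g).
  move=> P /[!inE] -[SP _]; apply: eq_bigr => i _.
  by rewrite sq_dist.
apply: continuous_in_subspaceT => A /[!inE] CA.
have FA : Filter (nbhs A) := nbhs_filter A.
apply: (@cvg_sumr _ _ (nbhs A) FA n (fun i B => k i / 2 * cangle2 (cosang (Rs i) B))
  (fun i => k i / 2 * cangle2 (cosang (Rs i) A))) => i.
apply: cvgM; first exact: cvg_cst.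
apply: (@continuous_comp _ _ _ (cosang (Rs i)) cangle2); first exact: continuous_cosang.
exact/is_derive1_continuous/is_derive1_cangle2/ball_dom.
Qed.

Lemma minimizer_exists : exists P, is_minimizer F C P.
Proof.
have [||P] := @compact_EVT_min _ R F C _ compact_center_ball.
- by exists Rc; exact: ball_center.
- exact: continuous_sumsq.
by rewrite inE => CP Pmin; exists P; split => // Q CQ; apply: Pmin; rewrite inE.
Qed.

Lemma minimizer_unique P Q : is_minimizer F C P -> is_minimizer F C Q -> P = Q.
Proof.
move=> [CP Pmin] [CQ Qmin]; have [SP _] := CP; have [SQ _] := CQ.
have [_ conv] := closed_ball_convex SRc rho0.
have [[x [mx _]] geo] := conv P Q CP CQ.
have [xQ nx] := mx.
have CG t : 0 <= t <= 1 -> C (geodesic P x t) by exact: geo.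
have [x0|x0] := eqVneq x 0.
  by rewrite -xQ x0 /geodesic hat0 scaler0 expm0 mulmx1.
exfalso; apply: (@no_min_at_both_ends R (fun t => F (geodesic P x t))
  (fun t => dot (sumgrad k Rs (geodesic P x t)) x)
  (fun t => dot (sumhess k Rs (geodesic P x t) *m x) x)).
- by move=> t t01; apply: is_derive_sumsq => //; exact/ball_dom/CG.
- by move=> t t01; apply: is_derive_sumsq2 => //; exact/ball_dom/CG.
- move=> t t01; apply: lt_le_trans (sumhess_ball x (CG t t01)).
  rewrite mulr_gt0 ?mu_gt0// lt_neqAle dot_ge0 andbT eq_sym.
  apply: contra_neq x0 => xx; apply: norm2_eq0.
  by rewrite /norm2 xx sqrtr0.
- by move=> t t01; rewrite geodesic0; exact/Pmin/CG.
- by rewrite geodesic0 xQ; apply/eqP; rewrite eq_le Pmin//= Qmin.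
Qed.

(* Beyond the radius r0, moving towards the centre decreases every term. *)
Lemma minimizer_near P : is_minimizer F C P -> dist P Rc <= r0.
Proof.
move=> [CP Pmin]; have [SP dP] := CP; rewrite leNgt; apply/negP => rP.
have [m [m1 E]] := rot_dist SP SRc; set s := dist P Rc in dP rP E.
have s0 : 0 < s < pi / 2.
  by case/andP: r00 => ? _; case/andP: rho0 => _ ?; apply/andP; split; lra.
have spi : 0 <= s <= pi by rewrite dist_ge0//= dist_lepi.
(* The unit-speed geodesic towards [Rc] is at distance [s - t] from it at time [t], so it stays in
   the ball and is admissible for comparison. *)
have CG t : 0 <= t <= s -> C (geodesic P m t).
  move=> /andP[t0 ts]; split; first exact: SO3_geodesic.
  have SG := SO3_geodesic m t SP.
  have EG : (geodesic P m t)^T *m Rc = rot (s - t) m.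
    rewrite -(scale1r m) geodesic_rot// mulr1 trmx_mul -mulmxA E /rot axrot_tr.
    by rewrite -sinN -(cosN t) -/(rot (- t) m) -/(rot s m) scale1r rot_commute// addrC.
  rewrite dist_acos// (cosang_rot m1 EG) acos_cos; first lra.
  by case/andP: spi => ? ?; apply/andP; split; lra.
have d := @is_derive_sumsq R n k Rs SRs P m 0 SP.
rewrite geodesic0 in d; have {}d := d (ball_dom CP).
have s00 : 0 < s by case/andP: s0.
have := is_derive_ge0_at_min d s00.
have H t : 0 <= t <= s -> F (geodesic P m 0) <= F (geodesic P m t).
  by move=> ts; rewrite geodesic0; exact/Pmin/CG.
move=> /(_ H); rewrite /sumgrad dot_sumr leNgt => /negP; apply.
have lt0 i : dot (gradsq (k i) (Rs i) P) m < 0.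
  rewrite dotC; apply: (dot_axis_gradsq_lt0 (k0 i) SP SRc (SRs i) m1 s0 E).
    by rewrite dist_sym// (le_lt_trans (dRs i)).
  by rewrite (le_lt_trans (ball_dist i CP))//; case/andP: rho_r0.
rewrite (bigD1 (Ordinal n0))//= ltr_nwDl// sumr_le0// => i _; exact: ltW.
Qed.

Lemma interior_ball P : SO3 P -> dist P Rc < rho -> interior_SO3 C P.
Proof.
move=> SP dP; split=> //.
have : @nbhs_subspace _ (@SO3 R) P C; last by [].
rewrite -nbhs_subspace_in//.
have FP : Filter (nbhs P) := nbhs_filter P.
have u0 : cos rho < cosang Rc P.
  by rewrite cosangC -dist_lt_cosang// rho_pi.
have : \forall Q \near P, cos rho < cosang Rc Q.
  exact: (@continuous_cosang R Rc P _ (lt_nbhsr u0)).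
apply: filterS => Q rQ SQ; split=> //.
by rewrite dist_le_cosang// ?rho_pi// cosangC ltW.
Qed.

End MainTheorem.

Theorem mainTheorem4 (R : realType) (n : nat) (Rc : 'M[R]_3) (rho r0 : R)
    (k : 'I_n -> R) (Rs : 'I_n -> 'M[R]_3) :
  (0 < n)%N ->
  SO3 Rc -> 0 < rho < pi / 2 -> 0 <= r0 < rho ->
  (forall i, 0 < k i) ->
  (forall i, SO3 (Rs i)) -> (forall i, dist (Rs i) Rc <= r0) ->
  let C := closed_ball_SO3 Rc rho in
  let f := fun (i : 'I_n) (P : 'M[R]_3) => k i / 2 * dist P (Rs i) ^+ 2 in
  let F := fun P : 'M[R]_3 => \sum_(i < n) f i P in
  let Mi := fun i : 'I_n => k i * (rho + r0) in
  let M := \big[Num.max/0]_(i < n) Mi i in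
  let muF := (\sum_(i < n) k i) * ((rho + r0) / 2) * cot ((rho + r0) / 2) in
  (exists U : set 'M[R]_3,
     [/\ open_SO3 U, C `<=` U & forall i, C2_on (f i) U]) /\
  (forall i P, SO3 P -> dist P Rc = rho ->
     dot (unit_log_toward Rc P) (nabla (f i) P) <= 0) /\
  ((forall i P, C P ->
      norm2 (nabla (f i) P) = k i * dist P (Rs i) /\
      k i * dist P (Rs i) <= Mi i) /\
   (exists2 m, is_maximum
      [set y | exists i P, C P /\ y = norm2 (nabla (f i) P)] m & m <= M)) /\
  (geodesically_strongly_convex muF F C /\ 0 < muF) /\
  (exists Rmin, [/\ is_minimizer F C Rmin,
     forall Q, is_minimizer F C Q -> Q = Rmin,
     dist Rmin Rc <= r0 < rho
   & interior_SO3 C Rmin]).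
Proof.
move=> n0 SRc rho0 r00 k0 SRs dRs C f F Mi M muF.
have [P Pmin] := minimizer_exists k SRc rho0 r00 SRs dRs.
have dP := minimizer_near n0 SRc rho0 r00 k0 SRs dRs Pmin.
have [_ rr] := andP r00; have [[SP _] _] := Pmin.
split; [|split; [|split; [|split]]].
- exists (cosang_nbhd Rs); split; first exact: open_cosang_nbhd.
    exact: ball_nbhd SRc rho0 r00 SRs dRs.
  exact: C2_on_sq.
- exact: boundary_inward SRc rho0 r00 k0 SRs dRs.
- split; last exact: max_grad_norm.
  move=> i Q CQ; split; first exact: norm_nabla SRc rho0 r00 k0 SRs dRs i Q CQ.
  by apply: ler_wpM2l; [exact: ltW|exact: (ball_dist SRc SRs dRs i CQ)].
- split; first exact: strongly_convex.
  exact: mu_gt0.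
- exists P; split=> //.
  + by move=> Q Qmin; exact: (minimizer_unique n0 SRc rho0 r00 k0 SRs dRs Qmin Pmin).
  + by rewrite dP rr.
  + by apply: interior_ball => //; exact: le_lt_trans dP rr.
Qed.
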